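(* Let $$x \frac{\partial Y}{\partial x} = A(x,y) Y,\qquad y \frac{\partial Y}{\partial y} = B(x,y) Y$$ be a completely integrable Pfaffian system with normal crossings in two variables, of dimension $n$, with $A(x,y)=x^{-p}(A_0(y)+A_1(y)x+A_2(y)x^2+\dots)$ and $B(x,y)=y^{-q}(B_0(x)+B_1(x)y+B_2(x)y^2+\dots)$. Then the $x$-exponential parts of this system are those of the ordinary differential system $x\frac{dY}{dx}=A(x,0)\,Y$, and the $y$-exponential parts of this system are those of the ordinary differential system $y\frac{dY}{dy}=B(0,y)\,Y$.
   Context: A completely integrable Pfaffian system with normal crossings in two variables is a system $x\,\partial Y/\partial x = AY$, $y\,\partial Y/\partial y = BY$, with $Y$ an unknown $n$-dimensional column vector, $p,q$ nonnegative integers, $x^pA$ and $y^qB$ matrices in $\mathbb{C}[[x,y]]^{n\times n}$ with nonzero leading coefficients $A_0(y)=(x^pA)|_{x=0}$ and $B_0(x)=(y^qB)|_{y=0}$, satisfying the integrability condition $x\frac{\partial B}{\partial x}+BA = y\frac{\partial A}{\partial y}+AB$. The associated ordinary differential systems are $x\frac{dY}{dx}=A(x,0)Y$ and $y\frac{dY}{dy}=B(0,y)Y$. Exponential parts of the bivariate system: it is known that there exist positive integers $\alpha_1,\alpha_2$ and, with $x=t_1^{\alpha_1}$, $y=t_2^{\alpha_2}$, an invertible matrix $T$ over the fraction field of $\mathbb{C}[[t_1,t_2]]$ such that $Y=TZ$ transforms the system into $\frac{\partial Z}{\partial t_i}=\tilde A^{(i)}(t_i)Z$, $i=1,2$, where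 $\tilde A^{(i)}(t_i)=\mathrm{Diag}(\tilde A^i_1,\dots,\tilde A^i_h)$, $\tilde A^i_k=w^i_k(t_i)I_{n_k}+t_i^{-1}N^i_k$, $n_1+\dots+n_h=n$, $N^i_k$ is a constant nilpotent upper triangular complex $n_k\times n_k$ matrix, and $w^i_k(t_i)=\sum_{j=1}^{\alpha_ip_i+1}\xi_{ijk}t_i^{-j}$ with $\xi_{ijk}\in\mathbb{C}$, $(p_1,p_2)=(p,q)$. The $x$-exponential parts (resp. $y$-exponential parts) are the truncations $\bar w^i_k(t_i)=\sum_{j\ge2}\xi_{ijk}t_i^{-j}$ for $i=1$ (resp. $i=2$), where $\bar w^i_k$ is repeated $n_k$ times, giving a list of $n$ elements up to permutation. They do not depend on the choice of $T$; parts computed with different ramifications are identified by identifying the corresponding forms $\bar w^i_k(t_i)\,dt_i$ in terms of fractional powers of the original variable. Exponential parts of an ordinary differential system $x\frac{dY}{dx}=M(x)Y$, $M\in\mathbb{C}((x))^{n\times n}$, are defined in the same way with a single variable: after $x=t^{\alpha}$ and $Y=TZ$ with $T\in GL_n(\mathbb{C}((t)))$ putting the system in the form $\frac{dZ}{dt}=\mathrm{Diag}(w_k(t)I_{n_k}+t^{-1}N_k)Z$ with $w_k\in t^{-1}\mathbb{C}[t^{-1}]$ and $N_k$ constant nilpotent (Hukuhara-Turrittin normal form), they are the truncations of $w_k$ to the powers $t^{-j}$, $j\ge 2$, each repeated $n_k$ times. *)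

(* Defs.v *)
From HB Require Import structures.
From mathcomp Require Import all_boot all_order all_algebra.
From mathcomp Require Import generic_quotient.
From mathcomp Require Import ring.
From mathcomp Require Import boolp reals.
From mathcomp.real_closed Require Export complex.

Set Implicit Arguments.
Unset Strict Implicit.
Unset Printing Implicit Defensive.

Import GRing.Theory.
Local Open Scope ring_scope.
Local Open Scope quotient_scope.

Record fps (R : Type) := Fps { fcoef : nat -> R }.

Notation "{ 'fps' R }" := (fps R) (at level 0, format "{ 'fps'  R }") : type_scope.

HB.instance Definition _ (R : Type) := [isNew for @fcoef R].
HB.instance Definition _ (R : choiceType) := [Choice of {fps R} by <:].

Lemma fpsP (R : Type) (f g : {fps R}) : fcoef f =1 fcoef g -> f = g.
Proof. by case: f g => [f] [g] /= /funext ->. Qed.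

Section FpsRing.
Variable R : comNzRingType.
Implicit Types f g h : {fps R}.

Definition fps0 : {fps R} := Fps (fun=> 0).
Definition fpsC (c : R) : {fps R} := Fps (fun n => if n == 0%N then c else 0).
Definition fpsX : {fps R} := Fps (fun n => (n == 1%N)%:R).
Definition fps_opp f : {fps R} := Fps (fun n => - fcoef f n).
Definition fps_add f g : {fps R} := Fps (fun n => fcoef f n + fcoef g n).
Definition fps_mul f g : {fps R} :=
  Fps (fun n => \sum_(i < n.+1) fcoef f i * fcoef g (n - i)%N).

Fact fps_addA : associative fps_add.
Proof. by move=> f g h; apply: fpsP => n /=; rewrite addrA. Qed.
Fact fps_addC : commutative fps_add.
Proof. by move=> f g; apply: fpsP => n /=; rewrite addrC. Qed.
Fact fps_add0 : left_id fps0 fps_add.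
Proof. by move=> f; apply: fpsP => n /=; rewrite add0r. Qed.
Fact fps_addN : left_inverse fps0 fps_opp fps_add.
Proof. by move=> f; apply: fpsP => n /=; rewrite addNr. Qed.

HB.instance Definition _ := GRing.isZmodule.Build {fps R}
  fps_addA fps_addC fps_add0 fps_addN.

Definition ftrunc n f : {poly R} := \poly_(i < n) fcoef f i.

Lemma fcoef_mul_trunc m n f g : (n < m)%N ->
  fcoef (fps_mul f g) n = (ftrunc m f * ftrunc m g)`_n.
Proof.
move=> nm; rewrite coefM /=; apply: eq_bigr => i _.
by rewrite !coef_poly (leq_ltn_trans (leq_subr _ _) nm)
           (leq_trans (ltn_ord i) nm).
Qed.

Fact fps_mulC : commutative fps_mul.
Proof.
by move=> f g; apply: fpsP => n; rewrite !(@fcoef_mul_trunc n.+1) // mulrC.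
Qed.

Fact fps_mulA : associative fps_mul.
Proof.
move=> f g h; apply: fpsP => n.
rewrite !(@fcoef_mul_trunc n.+1) //.
transitivity (ftrunc n.+1 f * (ftrunc n.+1 g * ftrunc n.+1 h))`_n.
  rewrite !(coefM (ftrunc n.+1 f)); apply: eq_bigr => i _; congr (_ * _).
  have lt : (n - i < n.+1)%N by rewrite ltnS leq_subr.
  by rewrite [LHS]coef_poly lt (@fcoef_mul_trunc n.+1).
rewrite mulrA [LHS]coefMr [RHS]coefMr; apply: eq_bigr => i _; congr (_ * _).
have lt : (n - i < n.+1)%N by rewrite ltnS leq_subr.
by rewrite [RHS]coef_poly lt (@fcoef_mul_trunc n.+1).
Qed.

Fact fps_mul1 : left_id (fpsC 1) fps_mul.
Proof.
move=> f; apply: fpsP => n /=.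
by rewrite big_ord_recl /= mul1r subn0 big1 ?addr0 // => i _; rewrite mul0r.
Qed.

Fact fps_mulDl : left_distributive fps_mul fps_add.
Proof.
move=> f g h; apply: fpsP => n /=.
by rewrite -big_split; apply: eq_bigr => i _; rewrite mulrDl.
Qed.

Fact fps1_neq0 : fpsC 1 != 0 :> {fps R}.
Proof.
by apply/eqP => /(congr1 (fun f => fcoef f 0)) /= /eqP; rewrite oner_eq0.
Qed.

HB.instance Definition _ := GRing.Zmodule_isComNzRing.Build {fps R}
  fps_mulA fps_mulC fps_mul1 fps_mulDl fps1_neq0.

Definition fps_unit : pred {fps R} := fun f => `[< exists g, g * f = 1 >].

Definition fps_inv f : {fps R} :=
  if pselect (exists g, g * f = 1) is left ex then sval (cid ex) else f.

Fact fps_mulVf : {in fps_unit, left_inverse 1 fps_inv *%R}.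
Proof.
move=> f /asboolP uf; rewrite /fps_inv; case: pselect => // ex.
by case: cid.
Qed.

Fact fps_unitP f g : g * f = 1 -> fps_unit f.
Proof. by move=> gf; apply/asboolP; exists g. Qed.

Fact fps_invr_out : {in [predC fps_unit], fps_inv =1 id}.
Proof.
by move=> f /asboolP nuf; rewrite /fps_inv; case: pselect.
Qed.

HB.instance Definition _ := GRing.ComNzRing_hasMulInverse.Build {fps R}
  fps_mulVf fps_unitP fps_invr_out.

Definition fps_deriv f : {fps R} := Fps (fun n => fcoef f n.+1 *+ n.+1).

(* f(t) |-> f(t^a), for a > 0 *)
Definition fps_ramify (a : nat) f : {fps R} :=
  Fps (fun n => if (a %| n)%N then fcoef f (n %/ a)%N else 0).

End FpsRing.

Arguments fpsX {R}.

Definition fps_map (R S : Type) (u : R -> S) (f : {fps R}) : {fps S} :=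
  Fps (fun n => u (fcoef f n)).

Section FpsDomain.
Variable R : idomainType.

Fact fps_integral : GRing.integral_domain_axiom {fps R}.
Proof.
move=> f g; have [->|f0 /=] := eqVneq f 0; first by [].
have [->|g0 fg0] := eqVneq g 0; first by [].
have low (h : {fps R}) : h != 0 ->
    exists2 n, fcoef h n != 0 & forall i, (i < n)%N -> fcoef h i = 0.
  move=> h0; have ex : exists n, fcoef h n != 0.
    apply: contrapT => nex; case/eqP: h0; apply: fpsP => n /=.
    by apply: contrapT => /eqP hn; apply: nex; exists n.
  exists (ex_minn ex); case: ex_minnP => // n _ mn i lt.
  by apply/eqP; apply: contraTT lt => /mn; rewrite -leqNgt.
have [m fm lf] := low _ f0; have [n gn lg] := low _ g0.
have := congr1 (fun h => fcoef h (m + n)%N) fg0; rewrite /=.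
have lt : (m < (m + n).+1)%N by rewrite ltnS leq_addr.
rewrite (bigD1 (Ordinal lt)) //= addKn big1 ?addr0 => [/eqP|i im].
  by rewrite mulf_eq0 (negPf fm) (negPf gn).
have [im'|mi] := ltnP i m; first by rewrite lf ?mul0r.
rewrite [X in _ * X]lg ?mulr0 //.
have mi' : (m < i)%N.
  rewrite ltn_neqAle mi andbT; apply: contra im => /eqP e.
  by apply/eqP/val_inj.
have lti : (i <= m + n)%N by rewrite -ltnS ltn_ord.
by rewrite -(ltn_add2l i) subnKC // ltn_add2r.
Qed.

HB.instance Definition _ :=
  GRing.ComUnitRing_isIntegral.Build {fps R} fps_integral.

End FpsDomain.

Notation "x %:F" := (FracField.tofrac x) : ring_scope.

(* For an injective ring morphism u (resp. a derivation d) these do not depend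
   on the representative of z: see frac_map_div and frac_deriv_div. *)
Definition frac_map (R S : idomainType) (u : R -> S) (z : {fraction R}) :
    {fraction S} :=
  (u \n_(repr z))%:F / (u \d_(repr z))%:F.

Definition frac_deriv (R : idomainType) (d : R -> R) (z : {fraction R}) :
    {fraction R} :=
  let a := \n_(repr z) in let b := \d_(repr z) in
  (d a * b - a * d b)%:F / (b ^+ 2)%:F.

Section FracExtension.
Variables R S : idomainType.

Lemma frac_repr (z : {fraction R}) :
  z = (\n_(repr z))%:F / (\d_(repr z))%:F.
Proof.
have d0 : \d_(repr z) != 0 by apply: denom_ratioP.
apply: (canRL (mulfK _)); first by rewrite tofrac_eq0.
rewrite -{1}[z]reprK; unlock FracField.tofrac.
rewrite -[LHS]FracField.pi_mul; apply/eqmodP.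
rewrite /= FracField.equivfE /FracField.mulf.
by rewrite !numden_Ratio ?mulf_neq0 ?oner_neq0 // !mulr1 mulrC.
Qed.

Lemma frac_eq (z : {fraction R}) a b : b != 0 -> z = a%:F / b%:F ->
  \n_(repr z) * b = a * \d_(repr z).
Proof.
move=> b0; have d0 : \d_(repr z) != 0 by apply: denom_ratioP.
rewrite {1}[z]frac_repr => /eqP.
by rewrite eqr_div ?tofrac_eq0 // -!tofracM tofrac_eq => /eqP.
Qed.

Lemma frac_map_div (u : {rmorphism R -> S}) a b :
  injective u -> b != 0 ->
  frac_map u (a%:F / b%:F) = (u a)%:F / (u b)%:F.
Proof.
move=> uI b0; set z := _ / _.
have ub (c : R) : c != 0 -> (u c)%:F != 0.
  by rewrite tofrac_eq0; apply: contra => /eqP; rewrite -(rmorph0 u) => /uI ->.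
have /eqP d0 := denom_ratioP (repr z).
apply/eqP; rewrite /frac_map eqr_div ?ub //; last exact/eqP.
by rewrite -!tofracM -!rmorphM (frac_eq b0 (erefl z)).
Qed.

Lemma frac_deriv_div (d : {additive R -> R}) a b :
  (forall x y, d (x * y) = d x * y + x * d y) -> b != 0 ->
  frac_deriv d (a%:F / b%:F) = (d a * b - a * d b)%:F / (b ^+ 2)%:F.
Proof.
move=> dM b0; set z := _ / _; rewrite /frac_deriv.
have e := frac_eq b0 (erefl z); have q0 := denom_ratioP (repr z).
move: e q0; set m := \n_(repr z); set q := \d_(repr z) => e q0.
apply/eqP; rewrite eqr_div ?tofrac_eq0 ?expf_neq0 //.
rewrite -!tofracM tofrac_eq; apply/eqP.
have := congr1 d e; rewrite !dM => e'.
have -> : (d m * q - m * d q) * b ^+ 2 =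
    (d m * b + m * d b) * (q * b) - m * b * (d b * q + b * d q) by ring.
by rewrite e' e; ring.
Qed.

End FracExtension.

(* The matrix of dZ/dt = (T^-1 M T - T^-1 T') Z, obtained from dY/dt = M Y
   by the substitution Y = T Z. *)
Definition gauge (K : fieldType) (d : K -> K) n (T M : 'M[K]_n) : 'M[K]_n :=
  invmx T *m (M *m T - map_mx d T).

Record block_shape (n : nat) := BlockShape {
  nblocks : nat;
  bdim : 'I_nblocks -> nat;
  sum_bdim : (\sum_k bdim k)%N = n
}.

Arguments bdim {n} b k.

Definition block_diag (K : fieldType) n (s : block_shape n)
    (D : forall k, 'M[K]_(bdim s k)) : 'M[K]_n :=
  castmx (sum_bdim s, sum_bdim s) (\mxdiag_k D k).

(* A polar part sum_(j >= 1) xi_j t^-j is encoded by the polynomial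
   w = sum_(j >= 1) xi_j 'X^j without constant term. *)
Definition polar_part (F : fieldType) (w : {poly F}) : Prop := w`_0 = 0.

Definition upper_nilpotent (F : fieldType) m (N : 'M[F]_m) : Prop :=
  is_trig_mx N^T /\ exists r, N ^+ r = 0.

(* w(t) I + t^-1 N, where iota : F -> K embeds the constants and t : K. *)
Definition exp_block (F K : fieldType) (iota : F -> K) (t : K) m
    (w : {poly F}) (N : 'M[F]_m) : 'M[K]_m :=
  (map_poly iota w).[t^-1]%:M + t^-1 *: map_mx iota N.

(* The form wbar(t) dt, with wbar = sum_(j >= 2) xi_j t^-j and x = t^a, written
   as sum_r c_r x^r dx and encoded by the function r |-> c_r.  Indeed
   t^-j dt = a^-1 x^((1 - j) / a - 1) dx. *)
Definition puiseux_form (F : fieldType) (a : nat) (w : {poly F}) : rat -> F :=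
  fun r => \sum_(2 <= j < size w | r == (1 - j%:R) / a%:R - 1) w`_j / a%:R.

Definition exp_list (F : fieldType) n (s : block_shape n) (a : nat)
    (w : 'I_(nblocks s) -> {poly F}) : seq (rat -> F) :=
  flatten [seq nseq (bdim s k) (puiseux_form a (w k)) | k <- enum 'I_(nblocks s)].

Notation laurent F := {fraction {fps F}}.

Section Ode.
Variable F : fieldType.

Definition lconst (c : F) : laurent F := (fpsC c)%:F.
Definition lvar : laurent F := (fpsX : {fps F})%:F.
Definition lderiv : laurent F -> laurent F := frac_deriv (@fps_deriv F).
Definition lramify (a : nat) : laurent F -> laurent F :=
  frac_map (@fps_ramify F a).

(* The matrix of dY/dt, for the system x dY/dx = M Y and x = t^a. *)
Definition ode_ramified (a : nat) n (M : 'M[laurent F]_n) : 'M[laurent F]_n :=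
  (a%:R / lvar) *: map_mx (lramify a) M.

(* E lists, up to permutation, the exponential parts of x dY/dx = M Y. *)
Definition ode_exp_parts n (M : 'M[laurent F]_n) (E : seq (rat -> F)) : Prop :=
  exists (a : nat) (s : block_shape n) (w : 'I_(nblocks s) -> {poly F})
    (N : forall k, 'M[F]_(bdim s k)) (T : 'M[laurent F]_n),
  [/\ (0 < a)%N,
      forall k, polar_part (w k) /\ exists r, N k ^+ r = 0,
      T \in unitmx,
      gauge lderiv T (ode_ramified a M)
        = block_diag (fun k => exp_block lconst lvar (w k) (N k))
    & perm_eq E (exp_list a w)].

End Ode.

(* C[[x,y]] is {fps {fps C}}: the outer variable is x, the inner one is y. *)
Notation laurent2 F := {fraction {fps {fps F}}}.

Section Pfaffian.
Variable F : fieldType.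
Implicit Types f : {fps {fps F}}.

Definition const2 (c : F) : laurent2 F := (fpsC (fpsC c))%:F.
Definition var_x : laurent2 F := (fpsX : {fps {fps F}})%:F.
Definition var_y : laurent2 F := (fpsC (fpsX : {fps F}))%:F.

Definition deriv_x : laurent2 F -> laurent2 F :=
  frac_deriv (@fps_deriv {fps F}).
Definition deriv_y : laurent2 F -> laurent2 F :=
  frac_deriv (fps_map (@fps_deriv F)).

(* f(x, y) |-> f(x^a, y^b) *)
Definition ramify2 (a b : nat) : laurent2 F -> laurent2 F :=
  frac_map (fun f => fps_ramify a (fps_map (fps_ramify b) f)).

Definition at_x0 f : {fps F} := fcoef f 0.
Definition at_y0 f : {fps F} := fps_map (fun g => fcoef g 0) f.

Record pfaffian_system (n p q : nat) := PfaffianSystem {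
  numA : 'M[{fps {fps F}}]_n;
  numB : 'M[{fps {fps F}}]_n;
  matA : 'M[laurent2 F]_n := var_x ^- p *: map_mx (@FracField.tofrac _) numA;
  matB : 'M[laurent2 F]_n := var_y ^- q *: map_mx (@FracField.tofrac _) numB;
  leadA : map_mx at_x0 numA != 0;
  leadB : map_mx at_y0 numB != 0;
  integrable : var_x *: map_mx deriv_x matB + matB *m matA
             = var_y *: map_mx deriv_y matA + matA *m matB
}.

Section System.
Variables (n p q : nat) (S : pfaffian_system n p q).

(* A(x, 0) = x^-p numA(x, 0) and B(0, y) = y^-q numB(0, y): A has no pole along
   y = 0 and B none along x = 0. *)
Definition matA_y0 : 'M[laurent F]_n :=
  lvar F ^- p *: map_mx (fun f => (at_y0 f)%:F) (numA S).
Definition matB_x0 : 'M[laurent F]_n :=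
  lvar F ^- q *: map_mx (fun f => (at_x0 f)%:F) (numB S).

(* Y = T Z transforms S, after x = t1^a1 and y = t2^a2, into
   dZ/dt_i = Diag_k (w^i_k(t_i) I + t_i^-1 N^i_k) Z  for i = 1, 2.
   The variables t1, t2 are again the outer and inner one. *)
Definition normal_form (a1 a2 : nat) (s : block_shape n)
    (w1 w2 : 'I_(nblocks s) -> {poly F})
    (N1 N2 : forall k, 'M[F]_(bdim s k)) (T : 'M[laurent2 F]_n) : Prop :=
  [/\ (0 < a1)%N /\ (0 < a2)%N,
      forall k, [/\ polar_part (w1 k), (size (w1 k) <= (a1 * p + 1).+1)%N
                  & upper_nilpotent (N1 k)],
      forall k, [/\ polar_part (w2 k), (size (w2 k) <= (a2 * q + 1).+1)%N
                  & upper_nilpotent (N2 k)],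
      T \in unitmx
    & gauge deriv_x T ((a1%:R / var_x) *: map_mx (ramify2 a1 a2) (matA S))
        = block_diag (fun k => exp_block const2 var_x (w1 k) (N1 k)) /\
      gauge deriv_y T ((a2%:R / var_y) *: map_mx (ramify2 a1 a2) (matB S))
        = block_diag (fun k => exp_block const2 var_y (w2 k) (N2 k))].

(* E lists, up to permutation, the x- (resp. y-) exponential parts of S. *)
Definition x_exp_parts (E : seq (rat -> F)) : Prop :=
  exists (a1 a2 : nat) (s : block_shape n) (w1 w2 : 'I_(nblocks s) -> {poly F})
    (N1 N2 : forall k, 'M[F]_(bdim s k)) (T : 'M[laurent2 F]_n),
  normal_form a1 a2 w1 w2 N1 N2 T /\ perm_eq E (exp_list a1 w1).

Definition y_exp_parts (E : seq (rat -> F)) : Prop :=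
  exists (a1 a2 : nat) (s : block_shape n) (w1 w2 : 'I_(nblocks s) -> {poly F})
    (N1 N2 : forall k, 'M[F]_(bdim s k)) (T : 'M[laurent2 F]_n),
  normal_form a1 a2 w1 w2 N1 N2 T /\ perm_eq E (exp_list a2 w2).

End System.
End Pfaffian.

(* Main.v *)
Require Import Defs.
From HB Require Import structures.
From mathcomp Require Import all_boot all_order all_algebra.
From mathcomp Require Import fingroup perm.
From mathcomp Require Import ring zify.
From mathcomp Require Import boolp reals.
From mathcomp.real_closed Require Import complex.

(** Why the theorem is true.  Consider the second variable y; the statement
    about x follows by exchanging the two variables ([swap_xy]).

    The fraction field of F[[x, y]] embeds into F((t))((x)), with y = t^a: a
    power series in x and y is a power series in x whose coefficients lie in
    F[[y]].  The matrix B of the equation y dY/dy = B Y has no pole along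
    x = 0, so it lands in F((t))[[x]], and its constant term in x is B(0, y).
    The derivation with respect to t acts on coefficients and kills x.
    A transformation T to normal form, even one whose denominators are
    arbitrary, therefore becomes x^-m V with V a matrix over F((t))[[x]], with
    nonzero determinant, such that V' = A V - V D ([expand_system]).  Here D
    is the normal form of the bivariate system, which does not involve x, and
    the constant term A(0) is the matrix of the restricted ordinary system,
    which may be assumed to be in normal form D' ([const_gauge]).

    The constant term of V need not be invertible, so D and D' cannot be
    compared by setting x = 0.  Instead A is made block diagonal: the blocks are
    labelled by the exponential parts of D', and there is a matrix P with
    constant term 1 such that P' = A P - P A' with A' block diagonal and
    A'(0) = D' ([block_gauge]).  The coefficients of P solve Sylvester
    equations X' = D' X - X D' + G over F((t)), with X and G supported off the
    blocks.  They are solvable because there w_i - w_j has a pole of order at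
    least 2, hence dominates both X' and the terms of order t^-1; the solution
    is the fixed point of a t-adic contraction ([sylvester_solvable]).

    Now W = P^-1 V satisfies W' = A' W - W D.  Where the exponential parts of
    D' and D differ, the corresponding part of W vanishes: its first nonzero
    coefficient in x would solve a homogeneous Sylvester equation over F((t)),
    whose only solution is zero ([sylvester_unique]).  Since the determinant
    of W is not zero, some term of its expansion over permutations is not
    zero, and that permutation matches the exponential parts of D' with those
    of D ([det_on_blocks]).

    The two ramifications are reconciled by substituting a further power of
    the variable on each side.  This transforms normal forms into normal forms
    and leaves the exponential parts, written in fractional powers of the
    original variable, unchanged ([normal_mx_ramify], [puiseux_ramify]). *)

Set Implicit Arguments.
Unset Strict Implicit.
Unset Printing Implicit Defensive.

Import GRing.Theory.
Local Open Scope ring_scope.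

(** * Power series: contractions, coefficients, substitutions *)

Definition agree (T : Type) (k : nat) (f g : {fps T}) : Prop :=
  forall l, (l < k)%N -> fcoef f l = fcoef g l.

(** Contraction for the adic metric: each coefficient of the value depends only
    on the earlier coefficients of the argument.  The coefficients may lie in
    any type, so that series of matrices are covered. *)
Definition contracting (T : Type) (Psi : {fps T} -> {fps T}) : Prop :=
  forall k f g, agree k f g -> fcoef (Psi f) k = fcoef (Psi g) k.

(** The iterates stabilize coefficient by coefficient, and their limit is a fixed
    point. *)
Lemma contracting_fix (T : Type) (x0 : T) (Psi : {fps T} -> {fps T}) :
  contracting Psi -> exists f, Psi f = f.
Proof.
move=> ctr; pose it k := iter k Psi (Fps (fun=> x0)).
have step k : agree k (it k) (it k.+1).
  elim: k => [|k IHk] l // lk; apply: ctr => i il.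
  by apply: IHk; apply: leq_trans il lk.
have stab k m : agree k (it k) (it (m + k)%N).
  elim: m => [|m IHm] l lk //; rewrite IHm // addSn.
  by apply: step; apply: leq_trans lk _; rewrite leq_addl.
exists (Fps (fun l => fcoef (it l.+1) l)); apply: fpsP => k /=.
apply: ctr => l lk /=.
by have := stab l.+1 (k - l.+1)%N l (ltnSn l); rewrite subnK.
Qed.

Lemma contracting_unique (T : Type) (Psi : {fps T} -> {fps T}) f g :
  contracting Psi -> Psi f = f -> Psi g = g -> f = g.
Proof.
move=> ctr Pf Pg; suff all k : agree k f g by apply: fpsP => k; apply: (all k.+1).
elim: k => [|k IHk] l //; rewrite ltnS => lk; rewrite -Pf -Pg; apply: ctr => i il.
by apply: IHk; apply: leq_trans il lk.
Qed.

Section FpsMorphisms.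
Variable R : comNzRingType.
Implicit Types (f g : {fps R}).

Lemma fcoefM f g k : fcoef (f * g) k = \sum_(i < k.+1) fcoef f i * fcoef g (k - i)%N.
Proof. by []. Qed.

(** A named function, so that it can carry a morphism structure. *)
Definition coef_at k f := fcoef f k.
Fact coef_at_additive k : zmod_morphism (coef_at k).
Proof. by []. Qed.
HB.instance Definition _ k :=
  GRing.isZmodMorphism.Build {fps R} R (coef_at k) (coef_at_additive k).

Lemma fcoef_sum k (I : Type) (r : seq I) (P : pred I) (E : I -> {fps R}) :
  fcoef (\sum_(i <- r | P i) E i) k = \sum_(i <- r | P i) fcoef (E i) k.
Proof. exact: (raddf_sum (coef_at k)). Qed.

Lemma fcoefMn k f m : fcoef (f *+ m) k = fcoef f k *+ m.
Proof. exact: (raddfMn (coef_at k)). Qed.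

Fact fpsC_additive : zmod_morphism (@fpsC R).
Proof. by move=> x y; apply: fpsP => k /=; case: (k == 0%N); rewrite ?subr0. Qed.
HB.instance Definition _ :=
  GRing.isZmodMorphism.Build R {fps R} (@fpsC R) fpsC_additive.

Lemma fcoefCM c f k : fcoef (fpsC c * f) k = c * fcoef f k.
Proof.
rewrite fcoefM big_ord_recl /= subn0 big1 ?addr0 // => i _.
by rewrite mul0r.
Qed.

Lemma fcoefMC c f k : fcoef (f * fpsC c) k = fcoef f k * c.
Proof. by rewrite mulrC fcoefCM mulrC. Qed.

Fact fpsC_multiplicative : monoid_morphism (@fpsC R).
Proof.
split=> // x y; apply: fpsP => k; rewrite fcoefCM /=.
by case: (k == 0%N); rewrite ?mulr0.
Qed.
HB.instance Definition _ :=
  GRing.isMonoidMorphism.Build R {fps R} (@fpsC R) fpsC_multiplicative.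

Fact fps_deriv_additive : zmod_morphism (@fps_deriv R).
Proof. by move=> f g; apply: fpsP => k /=; rewrite mulrnBl. Qed.
HB.instance Definition _ :=
  GRing.isZmodMorphism.Build {fps R} {fps R} (@fps_deriv R) fps_deriv_additive.

Lemma fcoefXM f k : fcoef (fpsX * f) k = if k is l.+1 then fcoef f l else 0.
Proof.
rewrite fcoefM; case: k => [|k]; first by rewrite big_ord1 /= mul0r.
rewrite big_ord_recl /= mul0r add0r big_ord_recl /= mul1r subSS subn0.
by rewrite big1 ?addr0 // => i _; rewrite mul0r.
Qed.

Lemma fcoefXnM n f k :
  fcoef (fpsX ^+ n * f) k = if (k < n)%N then 0 else fcoef f (k - n)%N.
Proof.
elim: n k => [|n IHn] k; first by rewrite expr0 mul1r subn0.
by rewrite exprS -mulrA fcoefXM; case: k => [|k] //; rewrite IHn ltnS subSS.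
Qed.

Lemma fps_shift f n : (forall k, (k < n)%N -> fcoef f k = 0) ->
  f = fpsX ^+ n * Fps (fun k => fcoef f (k + n)%N).
Proof.
move=> f0; apply: fpsP => k; rewrite fcoefXnM.
by case: ltnP => [/f0//|nk] /=; rewrite subnK.
Qed.

Lemma fpsX_neq0 : fpsX != 0 :> {fps R}.
Proof.
apply/eqP => /(congr1 (fun f => fcoef f 1)) /= /eqP; by rewrite oner_eq0.
Qed.

End FpsMorphisms.

Section FpsMap.
Variables R S : comNzRingType.

Section Additive.
Variable u : {additive R -> S}.
Fact fps_map_additive : zmod_morphism (fps_map u).
Proof. by move=> f g; apply: fpsP => k /=; rewrite raddfB. Qed.
HB.instance Definition _ :=
  GRing.isZmodMorphism.Build {fps R} {fps S} (fps_map u) fps_map_additive.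
End Additive.

Section Multiplicative.
Variable u : {rmorphism R -> S}.
Fact fps_map_multiplicative : monoid_morphism (fps_map u).
Proof.
split=> [|f g]; first by apply: fpsP => -[|k] /=; rewrite ?rmorph1 ?rmorph0.
apply: fpsP => k; rewrite fcoefM /= rmorph_sum.
by apply: eq_bigr => i _; rewrite rmorphM.
Qed.
HB.instance Definition _ :=
  GRing.isMonoidMorphism.Build {fps R} {fps S} (fps_map u) fps_map_multiplicative.

Lemma fps_mapX : fps_map u fpsX = fpsX.
Proof. by apply: fpsP => k /=; rewrite rmorph_nat. Qed.

Lemma fps_mapC c : fps_map u (fpsC c) = fpsC (u c).
Proof. by apply: fpsP => k /=; case: eqP; rewrite ?rmorph0. Qed.

Lemma fps_map_inj : injective u -> injective (fps_map u).
Proof.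
move=> uI f g fg; apply: fpsP => k; apply: uI.
exact: (congr1 (fun h => fcoef h k) fg).
Qed.
End Multiplicative.
End FpsMap.

(** In iterated series f(x, y) the outer variable is x; this exchanges the roles
    of x and y, which reduces the case of the first variable to that of the
    second. *)
Definition fps_swap (R : Type) (f : {fps {fps R}}) : {fps {fps R}} :=
  Fps (fun j => Fps (fun i => fcoef (fcoef f i) j)).

Section Swap.
Variable R : comNzRingType.
Implicit Types f g : {fps {fps R}}.

Lemma fps_swapK : involutive (@fps_swap R).
Proof. by move=> f; apply: fpsP => i; apply: fpsP. Qed.

Fact fps_swap_additive : zmod_morphism (@fps_swap R).
Proof. by move=> f g; apply: fpsP => j; apply: fpsP. Qed.
HB.instance Definition _ := GRing.isZmodMorphism.Build
  {fps {fps R}} {fps {fps R}} (@fps_swap R) fps_swap_additive.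

Fact fps_swap_multiplicative : monoid_morphism (@fps_swap R).
Proof.
split=> [|f g]; apply: fpsP => j; apply: fpsP => i.
  by case: i j => [|i] [|j].
rewrite [LHS]/= -!/(GRing.mul _ _) fcoefM fcoef_sum fcoef_sum.
under eq_bigr do rewrite fcoefM.
under [RHS]eq_bigr do rewrite fcoefM.
by rewrite exchange_big.
Qed.
HB.instance Definition _ := GRing.isMonoidMorphism.Build
  {fps {fps R}} {fps {fps R}} (@fps_swap R) fps_swap_multiplicative.

Lemma fps_swapX : fps_swap (@fpsX {fps R}) = fpsC fpsX.
Proof.
by apply: fpsP => j; apply: fpsP => i /=; case: i j => [|[|i]] [|j].
Qed.

Lemma fps_swapCC (c : R) : fps_swap (fpsC (fpsC c)) = fpsC (fpsC c).
Proof. by apply: fpsP => j; apply: fpsP => i /=; case: i j => [|i] [|j]. Qed.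

Lemma fps_swap_deriv f :
  fps_swap (fps_deriv f) = fps_map (@fps_deriv R) (fps_swap f).
Proof.
apply: fpsP => j; apply: fpsP => i /=.
exact: (raddfMn (@coef_at R j)).
Qed.
End Swap.

Section Ramify.
Variables (R : comNzRingType) (a : nat) (a_gt0 : (0 < a)%N).
Implicit Types f g : {fps R}.

(** The positivity proof is an argument because [fps_ramify a] is a ring morphism
    for positive a only. *)
Definition ramify_fps of (0 < a)%N : {fps R} -> {fps R} := fps_ramify a.

Fact fps_ramify_additive : zmod_morphism (@fps_ramify R a).
Proof. by move=> f g; apply: fpsP => k /=; case: ifP; rewrite ?subr0. Qed.

Lemma sum_multiples (G : nat -> R) l : (forall i, ~~ (a %| i)%N -> G i = 0) ->
  \sum_(i < (l * a).+1) G i = \sum_(j < l.+1) G (j * a)%N.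
Proof.
move=> G0; rewrite -(big_mkord xpredT G) -(big_mkord xpredT (fun j => G (j * a)%N)).
elim: l => [|l IHl]; first by rewrite mul0n !big_nat1.
rewrite [RHS]big_nat_recr // -IHl /= (@big_cat_nat _ _ _ (l * a).+1) //=; last first.
  by rewrite ltnS leq_mul2r leqnSn orbT.
congr (_ + _); rewrite big_nat_recr /=; last by rewrite mulSn -[X in (X < _)%N]add0n ltn_add2r.
rewrite big_nat_cond big1 ?add0r // => i; rewrite andbT => /andP[li il].
apply: G0; apply/negP => /dvdnP[j e]; move: li il.
by rewrite e !ltn_mul2r a_gt0 /= ltnS => lj; rewrite leqNgt lj.
Qed.

Fact fps_ramify_multiplicative : monoid_morphism (@fps_ramify R a).
Proof.
split=> [|f g]; apply: fpsP => k; rewrite /=.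
  case: ifP => [/dvdnP[l ->]|]; first by rewrite mulnK // muln_eq0 (gtn_eqF a_gt0) orbF.
  by case: k => //; rewrite dvdn0.
case: ifP => [/dvdnP[l ->]|ak]; last first.
  rewrite big1 // => i _; case: ifP => ai; rewrite ?mul0r //.
  have ik : (i <= k)%N by rewrite -ltnS.
  by rewrite -(dvdn_addr _ ai) subnKC // ak mulr0.
rewrite mulnK //  (sum_multiples
  (G := fun i => fcoef (fps_ramify a f) i * fcoef (fps_ramify a g) (l * a - i)%N)).
  apply: eq_bigr => j _; rewrite /= -mulnBl !dvdn_mull // !mulnK //.
by move=> i /negPf /= ->; rewrite mul0r.
Qed.

HB.instance Definition _ := GRing.isZmodMorphism.Build
  {fps R} {fps R} (ramify_fps a_gt0) fps_ramify_additive.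
HB.instance Definition _ := GRing.isMonoidMorphism.Build
  {fps R} {fps R} (ramify_fps a_gt0) fps_ramify_multiplicative.

Lemma fps_ramifyC (c : R) : fps_ramify a (fpsC c) = fpsC c.
Proof.
apply: fpsP => k /=; case: ifP => [/dvdnP[l ->]|].
  by rewrite mulnK // muln_eq0 (gtn_eqF a_gt0) orbF.
by case: k => //; rewrite dvdn0.
Qed.

Lemma fps_ramifyX : fps_ramify a fpsX = fpsX ^+ a :> {fps R}.
Proof.
apply: fpsP => k; rewrite -[fpsX ^+ a]mulr1 fcoefXnM /=.
case: ifP => [/dvdnP[l ->]|]; last first.
  case: ltnP => // ak nak; have nk : a != k by apply: contraFN nak => /eqP->.
  by rewrite subn_eq0 leqNgt ltn_neqAle ak nk.
have -> : (l * a - a = (l - 1) * a)%N by rewrite mulnBl mul1n.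
have -> : (l * a < a)%N = (l < 1)%N.
  by rewrite -[X in (_ < X)%N]mul1n ltn_mul2r a_gt0.
rewrite mulnK // muln_eq0 (gtn_eqF a_gt0) orbF.
by case: l => [|[|l]].
Qed.

Lemma fps_ramify_inj : injective (@fps_ramify R a).
Proof.
move=> f g fg; apply: fpsP => k.
have /= := congr1 (fun h => fcoef h (k * a)%N) fg.
by rewrite dvdn_mull // mulnK.
Qed.

(** The chain rule for the substitution of a power. *)
Lemma fps_deriv_ramify f : fps_deriv (fps_ramify a f) =
  (a%:R * fpsX ^+ a.-1) * fps_ramify a (fps_deriv f).
Proof.
apply: fpsP => k; rewrite -mulrA mulr_natl fcoefMn fcoefXnM /=.
have [ka|ak] := ltnP.
  rewrite gtnNdvd ?mul0rn //; lia.
have -> : (a %| k.+1)%N = (a %| k - a.-1)%N.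
  rewrite -[k.+1](@subnK a) //; last by lia.
  by rewrite dvdn_addl //; congr (_ %| _)%N; lia.
case: ifP => [/dvdnP[l e]|]; last by rewrite !mul0rn.
have -> : k.+1 = (l.+1 * a)%N by rewrite mulSn; lia.
by rewrite e !mulnK // mulrnA.
Qed.

End Ramify.

Lemma fps_ramify_comm (R : comNzRingType) a b (f : {fps R}) : (0 < a)%N -> (0 < b)%N ->
  fps_ramify a (fps_ramify b f) = fps_ramify b (fps_ramify a f).
Proof.
suff E c d (g : {fps R}) : (0 < c)%N -> (0 < d)%N ->
    fps_ramify c (fps_ramify d g) = fps_ramify (c * d) g.
  by move=> a0 b0; rewrite !E // mulnC.
move=> c0 d0; apply: fpsP => k /=; case: ifP => [/dvdnP[l ->]|ck].
  by rewrite mulnK // [(c * d)%N]mulnC dvdn_pmul2r // divnMr.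
by case: ifP => // /dvdnP[l e]; rewrite e [(c * d)%N]mulnC mulnA dvdn_mull in ck.
Qed.

(** * Fraction fields and Laurent series *)

Definition leibniz (R : nzRingType) (d : R -> R) : Prop :=
  forall x y, d (x * y) = d x * y + x * d y.

Lemma leibniz1 (R : nzRingType) (d : R -> R) : leibniz d -> d 1 = 0.
Proof.
move=> dL; have /eqP := dL 1 1; rewrite !mulr1 mul1r -[X in X == _]addr0.
by rewrite (inj_eq (addrI _)) => /eqP.
Qed.

Lemma fracP (R : idomainType) (z : {fraction R}) :
  exists a b, b != 0 /\ z = a%:F / b%:F.
Proof.
do 2 eexists; split; last exact: frac_repr.
exact: denom_ratioP.
Qed.

Lemma tofrac_divB (R : idomainType) (a b c e : R) : b != 0 -> e != 0 ->
  a%:F / b%:F - c%:F / e%:F = (a * e - c * b)%:F / (b * e)%:F.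
Proof.
move=> b0 e0; rewrite -mulNr -tofracN addf_div ?tofrac_eq0 // -!tofracM.
by rewrite -tofracD mulNr.
Qed.

Section FracMap.
Variables (R S : idomainType) (u : {rmorphism R -> S}) (u_inj : injective u).

(** The injectivity proof is an argument because [frac_map u] is a field morphism
    only for injective u. *)
Definition frac_mapm of injective u : {fraction R} -> {fraction S} := frac_map u.

Lemma frac_map_tofrac a : frac_map u a%:F = (u a)%:F.
Proof. by rewrite -[a%:F]divr1 -tofrac1 frac_map_div ?oner_eq0 // rmorph1 divr1. Qed.

Fact frac_map_additive : zmod_morphism (frac_map u).
Proof.
move=> z w; have [a [b [b0 ->]]] := fracP z; have [c [e [e0 ->]]] := fracP w.
have ub0 x : x != 0 -> u x != 0.
  by apply: contra => /eqP; rewrite -(rmorph0 u) => /u_inj ->.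
rewrite tofrac_divB // !frac_map_div ?mulf_neq0 // tofrac_divB ?ub0 //.
by rewrite rmorphB !rmorphM.
Qed.

Fact frac_map_multiplicative : monoid_morphism (frac_map u).
Proof.
split=> [|z w]; first by rewrite -tofrac1 frac_map_tofrac rmorph1 tofrac1.
have [a [b [b0 ->]]] := fracP z; have [c [e [e0 ->]]] := fracP w.
rewrite mulf_div -!tofracM !frac_map_div ?mulf_neq0 // mulf_div.
by rewrite -!tofracM !rmorphM.
Qed.

HB.instance Definition _ := GRing.isZmodMorphism.Build
  {fraction R} {fraction S} (frac_mapm u_inj) frac_map_additive.
HB.instance Definition _ := GRing.isMonoidMorphism.Build
  {fraction R} {fraction S} (frac_mapm u_inj) frac_map_multiplicative.
End FracMap.

Section FracDeriv.
Variables (R : idomainType) (d : {additive R -> R}) (dL : leibniz d).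

(** Additivity of [frac_deriv d] rests on the Leibniz rule, whose proof is
    therefore an argument. *)
Definition frac_derivm of leibniz d : {fraction R} -> {fraction R} := frac_deriv d.

Fact frac_deriv_additive : zmod_morphism (frac_deriv d).
Proof.
move=> z w; have [a [b [b0 ->]]] := fracP z; have [c [e [e0 ->]]] := fracP w.
rewrite tofrac_divB // !frac_deriv_div ?mulf_neq0 // tofrac_divB ?expf_neq0 //.
apply/eqP; rewrite eqr_div ?tofrac_eq0 ?mulf_neq0 ?expf_neq0 ?mulf_neq0 //.
rewrite -!tofracM tofrac_eq raddfB /= !dL; apply/eqP; ring.
Qed.

Lemma frac_deriv_leibniz : leibniz (frac_deriv d).
Proof.
move=> z w; have [a [b [b0 ->]]] := fracP z; have [c [e [e0 ->]]] := fracP w.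
rewrite mulf_div -!tofracM !frac_deriv_div ?mulf_neq0 // !mulf_div.
rewrite -!tofracM addf_div ?tofrac_eq0 ?mulf_neq0 ?expf_neq0 // -!tofracM -tofracD.
apply/eqP; rewrite eqr_div ?tofrac_eq0 ?mulf_neq0 ?expf_neq0 ?mulf_neq0 //.
rewrite -!tofracM tofrac_eq /= !dL; apply/eqP; ring.
Qed.

HB.instance Definition _ := GRing.isZmodMorphism.Build
  {fraction R} {fraction R} (frac_derivm dL) frac_deriv_additive.

Lemma frac_deriv_tofrac a : frac_deriv d a%:F = (d a)%:F.
Proof.
rewrite -[a%:F]divr1 -tofrac1 frac_deriv_div ?oner_eq0 // (leibniz1 dL).
by rewrite mulr1 mulr0 subr0 expr1n tofrac1 divr1.
Qed.
End FracDeriv.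

Lemma leibnizX (R : comNzRingType) (d : {additive R -> R}) (x : R) n :
  leibniz d -> d (x ^+ n) = n%:R * x ^+ n.-1 * d x.
Proof.
move=> dL; elim: n => [|n IHn].
  by rewrite expr0 !mul0r (leibniz1 dL).
rewrite exprS dL IHn -natr1; case: n {IHn} => [|n] /=; first by rewrite !expr0; ring.
by rewrite exprS; ring.
Qed.

Lemma leibnizV (K : fieldType) (d : {additive K -> K}) (x : K) :
  leibniz d -> x != 0 -> d x^-1 = - d x / x ^+ 2.
Proof.
move=> dL x0; have := dL x x^-1; rewrite divff //.
rewrite (leibniz1 dL).
move=> /esym/eqP; rewrite addr_eq0 => /eqP e.
apply: (mulfI x0); rewrite -[LHS]opprK -e expr2 invfM.
by field.
Qed.

(** The chain rule survives the passage to fraction fields: k stands for the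
    derivative of the substitution u. *)
Lemma frac_deriv_map (R S : idomainType) (dR : {additive R -> R})
    (dS : {additive S -> S}) (u : {rmorphism R -> S}) (k : S) (z : {fraction R}) :
    leibniz dR -> leibniz dS -> injective u ->
    (forall a, dS (u a) = k * u (dR a)) ->
  frac_deriv dS (frac_map u z) = k%:F * frac_map u (frac_deriv dR z).
Proof.
move=> dRL dSL uI duk; have [a [b [b0 ->]]] := fracP z.
have ub0 : u b != 0 by apply: contra b0 => /eqP; rewrite -(rmorph0 u) => /uI ->.
rewrite frac_map_div // !frac_deriv_div // frac_map_div ?expf_neq0 //.
rewrite mulrA -tofracM (rmorphXn u) (rmorphB u) !(rmorphM u) /= !duk.
by congr (_%:F / _); ring.
Qed.

Section FpsDeriv.
Variable R : comNzRingType.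

Lemma fps_deriv_leibniz : leibniz (@fps_deriv R).
Proof.
move=> f g; apply: fpsP => k /=.
pose G i := fcoef f i * fcoef g (k.+1 - i)%N.
transitivity (\sum_(i < k.+2) (G i *+ i + G i *+ (k.+1 - i))).
  rewrite -sumrMnl; apply: eq_bigr => i _.
  by rewrite -mulrnDr subnKC // -ltnS.
rewrite big_split /= big_ord_recl mulr0n add0r; congr (_ + _).
  by apply: eq_bigr => i _; rewrite mulrnAl /G /= /bump add1n subSS.
rewrite big_ord_recr /= subnn mulr0n addr0; apply: eq_bigr => i _.
by rewrite /G mulrnAr subSn // -ltnS.
Qed.

Lemma fps_map_leibniz (d : {additive R -> R}) : leibniz d -> leibniz (fps_map d).
Proof.
move=> dL f g; apply: fpsP => k /=; rewrite raddf_sum -big_split /=.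
by apply: eq_bigr => i _; rewrite dL.
Qed.
End FpsDeriv.

Section Laurent.
Variable F : fieldType.
Implicit Types f g : {fps F}.

(** The inverse g of f is the fixed point of g = f_0^-1 (1 - (f - f_0) g), whose
    right-hand side is contracting because f - f_0 has no constant term. *)
Lemma fps_unit_coef0 f : fcoef f 0 != 0 -> f \is a GRing.unit.
Proof.
move=> f0; pose Psi g := Fps (fun k => (fcoef f 0)^-1 *
  ((k == 0%N)%:R - \sum_(i < k) fcoef f i.+1 * fcoef g (k - i.+1)%N)).
have ctr : contracting Psi.
  move=> k g h gh /=; congr (_ * (_ - _)); apply: eq_bigr => i _.
  by rewrite gh // ltn_subrL (leq_ltn_trans _ (ltn_ord i)).
have [g eg] := contracting_fix 0 ctr.
apply/unitrP; exists g; suff fg : f * g = 1 by split; rewrite // mulrC.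
apply: fpsP => k; rewrite fcoefM big_ord_recl subn0 -{1}eg /= mulVKf //.
by rewrite subrK; case: k.
Qed.

Lemma laurent_pole (z : laurent F) : exists m f, z = (lvar F ^+ m)^-1 * f%:F.
Proof.
have [a [b [b0 ->]]] := fracP z.
have ex : exists n, fcoef b n != 0.
  apply: contrapT => nex; case/eqP: b0; apply: fpsP => n /=.
  by apply: contrapT => /eqP hn; apply: nex; exists n.
case: (ex_minnP ex) => m bm mmin.
have eb : b = fpsX ^+ m * Fps (fun k => fcoef b (k + m)%N).
  apply: fps_shift => k; apply: contraTeq => /mmin; by rewrite -leqNgt.
set c := Fps _ in eb; have uc : c \is a GRing.unit by apply: fps_unit_coef0.
have c0 : c%:F != 0 :> laurent F.
  by rewrite tofrac_eq0; apply: contraTneq uc => ->; rewrite unitr0.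
exists m, (a * c^-1); rewrite {1}eb tofracM tofracXn invfM mulrCA -/(lvar F).
congr (_ * _); apply: (canLR (mulfK c0)).
by rewrite -tofracM divrK.
Qed.

Lemma lvar_neq0 : lvar F != 0.
Proof. by rewrite tofrac_eq0 fpsX_neq0. Qed.

(** Over a field of constants the nonzero series are powers of the variable up to
    units, so powers of the variable suffice as denominators. *)
Lemma laurent_mx_pole m n (X : 'M[laurent F]_(m, n)) :
  exists r (Y : 'M[{fps F}]_(m, n)),
    X = (lvar F ^+ r)^-1 *: map_mx (@FracField.tofrac _) Y.
Proof.
have /choice[rf erf] : forall ij : 'I_m * 'I_n, exists rf : nat * {fps F},
    X ij.1 ij.2 = (lvar F ^+ rf.1)^-1 * rf.2%:F.
  by move=> ij; have [r [f e]] := laurent_pole (X ij.1 ij.2); exists (r, f).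
pose r := (\max_ij (rf ij).1)%N.
exists r, (\matrix_(i, j) (fpsX ^+ (r - (rf (i, j)).1) * (rf (i, j)).2)).
apply/matrixP => i j; rewrite !mxE (erf (i, j)) tofracM tofracXn -/(lvar F) mulrA.
congr (_ * _); have le : ((rf (i, j)).1 <= r)%N by apply: (leq_bigmax (i, j)).
rewrite -{1}(subnKC le) exprD invfM mulrVK ?mulfV //.
by rewrite unitfE expf_neq0 // lvar_neq0.
Qed.

Fact lderiv_additive : zmod_morphism (@lderiv F).
Proof. exact: (@frac_deriv_additive _ _ (@fps_deriv_leibniz F)). Qed.
HB.instance Definition _ := GRing.isZmodMorphism.Build
  (laurent F) (laurent F) (@lderiv F) lderiv_additive.

Lemma lderiv_leibniz : leibniz (@lderiv F).
Proof. exact: (@frac_deriv_leibniz _ _ (@fps_deriv_leibniz F)). Qed.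

Lemma lderiv_tofrac f : lderiv f%:F = (fps_deriv f)%:F.
Proof. exact: (@frac_deriv_tofrac _ _ (@fps_deriv_leibniz F)). Qed.

End Laurent.

(** * Matrices of power series *)

Section MatrixCoefficients.
Variable R : comNzRingType.

Definition mx_coef m n k (X : 'M[{fps R}]_(m, n)) : 'M[R]_(m, n) :=
  map_mx (coef_at k) X.

Lemma mx_coefE m n k (X : 'M[{fps R}]_(m, n)) i j : mx_coef k X i j = fcoef (X i j) k.
Proof. by rewrite mxE. Qed.

Lemma mx_coefP m n (X Y : 'M[{fps R}]_(m, n)) :
  (forall k, mx_coef k X = mx_coef k Y) -> X = Y.
Proof.
move=> XY; apply/matrixP => i j; apply: fpsP => k.
by have /matrixP/(_ i j) := XY k; rewrite !mxE.
Qed.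

Lemma mx_coefD m n k (X Y : 'M[{fps R}]_(m, n)) :
  mx_coef k (X + Y) = mx_coef k X + mx_coef k Y.
Proof. exact: map_mxD. Qed.

Lemma mx_coefB m n k (X Y : 'M[{fps R}]_(m, n)) :
  mx_coef k (X - Y) = mx_coef k X - mx_coef k Y.
Proof. exact: map_mxB. Qed.

Lemma mx_coefM m n p k (X : 'M[{fps R}]_(m, n)) (Y : 'M[{fps R}]_(n, p)) :
  mx_coef k (X *m Y) = \sum_(i < k.+1) mx_coef i X *m mx_coef (k - i)%N Y.
Proof.
apply/matrixP => i j; rewrite !mxE summxE /coef_at fcoef_sum.
under eq_bigr do rewrite fcoefM.
rewrite exchange_big; apply: eq_bigr => l _; rewrite mxE.
by apply: eq_bigr => r _; rewrite !mxE.
Qed.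

Lemma mx_coefCM m n p k (N : 'M[R]_(m, n)) (Y : 'M[{fps R}]_(n, p)) :
  mx_coef k (map_mx (@fpsC R) N *m Y) = N *m mx_coef k Y.
Proof.
apply/matrixP => i j; rewrite !mxE /coef_at fcoef_sum.
by apply: eq_bigr => l _; rewrite !mxE fcoefCM.
Qed.

Lemma mx_coefMC m n p k (Y : 'M[{fps R}]_(m, n)) (N : 'M[R]_(n, p)) :
  mx_coef k (Y *m map_mx (@fpsC R) N) = mx_coef k Y *m N.
Proof.
apply/matrixP => i j; rewrite !mxE /coef_at fcoef_sum.
by apply: eq_bigr => l _; rewrite !mxE fcoefMC.
Qed.

Lemma mx_coefXM m n k (Y : 'M[{fps R}]_(m, n)) :
  mx_coef k (fpsX *: Y) = if k is l.+1 then mx_coef l Y else 0.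
Proof.
by apply/matrixP => i j; rewrite !mxE /coef_at fcoefXM; case: k => [|k]; rewrite !mxE.
Qed.

Definition mx_agree m n k (X Y : 'M[{fps R}]_(m, n)) : Prop :=
  forall l, (l < k)%N -> mx_coef l X = mx_coef l Y.

(** The transcription of [contracting] to matrices of series. *)
Definition mx_contracting m n (Psi : 'M[{fps R}]_(m, n) -> 'M[{fps R}]_(m, n)) :=
  forall k X Y, mx_agree k X Y -> mx_coef k (Psi X) = mx_coef k (Psi Y).

Section FixedPoint.
Variables (m n : nat) (Psi : 'M[{fps R}]_(m, n) -> 'M[{fps R}]_(m, n)).
Hypothesis Psi_ctr : mx_contracting Psi.

(* A matrix of series is the same as a series of matrices. *)
Let unzip (X : 'M[{fps R}]_(m, n)) := Fps (fun k => mx_coef k X).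
Let zip (f : {fps 'M[R]_(m, n)}) := \matrix_(i, j) Fps (fun k => fcoef f k i j).

Let unzipK : cancel unzip zip.
Proof. by move=> X; apply/matrixP => i j; apply: fpsP => k; rewrite !mxE /= !mxE. Qed.

Let mx_coef_zip k f : mx_coef k (zip f) = fcoef f k.
Proof. by apply/matrixP => i j; rewrite !mxE. Qed.

Let ctr : contracting (fun f => unzip (Psi (zip f))).
Proof. by move=> k f g fg /=; apply: Psi_ctr => l lk; rewrite !mx_coef_zip fg. Qed.

Lemma mx_contracting_fix : exists X, Psi X = X.
Proof.
have [f ef] := contracting_fix 0 ctr.
by exists (zip f); rewrite -{2}ef unzipK.
Qed.

Lemma mx_contracting_unique X Y : Psi X = X -> Psi Y = Y -> X = Y.
Proof.
move=> PX PY; apply: (can_inj unzipK).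
by apply: contracting_unique ctr _ _; rewrite unzipK ?PX ?PY.
Qed.
End FixedPoint.
End MatrixCoefficients.

(** * Blocks cut out by class labels *)

(** Rows carry the labels c1 and columns the labels c2.  An entry is on a block
    when its two labels agree.  In the applications the labels are exponential
    parts, and c1 and c2 may come from different systems. *)
Section Blocks.
Variables (C : eqType) (n : nat).
Implicit Types c : 'I_n -> C.

Definition on_blocks (R : nmodType) c1 c2 (X : 'M[R]_n) : Prop :=
  forall i j, c1 i <> c2 j -> X i j = 0.
Definition off_blocks (R : nmodType) c1 c2 (X : 'M[R]_n) : Prop :=
  forall i j, c1 i = c2 j -> X i j = 0.
Definition on_part (R : nmodType) c1 c2 (X : 'M[R]_n) : 'M[R]_n :=
  \matrix_(i, j) if c1 i == c2 j then X i j else 0.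
Definition off_part (R : nmodType) c1 c2 (X : 'M[R]_n) : 'M[R]_n :=
  \matrix_(i, j) if c1 i == c2 j then 0 else X i j.

Lemma on_partP (R : nmodType) c1 c2 (X : 'M[R]_n) : on_blocks c1 c2 (on_part c1 c2 X).
Proof. by move=> i j /eqP/negPf ne; rewrite mxE ne. Qed.

Lemma off_partP (R : nmodType) c1 c2 (X : 'M[R]_n) : off_blocks c1 c2 (off_part c1 c2 X).
Proof. by move=> i j /eqP e; rewrite mxE e. Qed.

Lemma off_part_id (R : nmodType) c1 c2 (X : 'M[R]_n) :
  off_blocks c1 c2 X -> off_part c1 c2 X = X.
Proof. by move=> oX; apply/matrixP => i j; rewrite mxE; case: eqP => // /oX. Qed.

Lemma on_off_part (R : nmodType) c1 c2 (X : 'M[R]_n) :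
  on_part c1 c2 X + off_part c1 c2 X = X.
Proof.
by apply/matrixP => i j; rewrite !mxE; case: eqP; rewrite ?addr0 ?add0r.
Qed.

Lemma off_part_additive (R : zmodType) c1 c2 :
  zmod_morphism (@off_part R c1 c2).
Proof. by move=> X Y; apply/matrixP => i j; rewrite !mxE; case: eqP; rewrite ?subr0. Qed.

Lemma on_part_additive (R : zmodType) c1 c2 :
  zmod_morphism (@on_part R c1 c2).
Proof. by move=> X Y; apply/matrixP => i j; rewrite !mxE; case: eqP; rewrite ?subr0. Qed.

HB.instance Definition _ (R : zmodType) c1 c2 := GRing.isZmodMorphism.Build
  'M[R]_n 'M[R]_n (@off_part R c1 c2) (@off_part_additive R c1 c2).
HB.instance Definition _ (R : zmodType) c1 c2 := GRing.isZmodMorphism.Build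
  'M[R]_n 'M[R]_n (@on_part R c1 c2) (@on_part_additive R c1 c2).

Lemma off_part_map (R S : zmodType) (u : {additive R -> S}) c1 c2 (X : 'M[R]_n) :
  off_part c1 c2 (map_mx u X) = map_mx u (off_part c1 c2 X).
Proof. by apply/matrixP => i j; rewrite !mxE; case: eqP => // _; rewrite raddf0. Qed.

Lemma on_part_map (R S : zmodType) (u : {additive R -> S}) c1 c2 (X : 'M[R]_n) :
  on_part c1 c2 (map_mx u X) = map_mx u (on_part c1 c2 X).
Proof. by apply/matrixP => i j; rewrite !mxE; case: eqP => // _; rewrite raddf0. Qed.

(** A block diagonal matrix does not mix rows with different labels. *)
Lemma off_partMl (R : nzRingType) c1 c2 (A X : 'M[R]_n) : on_blocks c1 c1 A ->
  off_part c1 c2 (A *m X) = A *m off_part c1 c2 X.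
Proof.
move=> oA; apply/matrixP => i j; rewrite !mxE; case: eqP => [e|ne].
  rewrite big1 // => k _; rewrite mxE; have [<-|/oA ->] := c1 i =P c1 k.
    by rewrite e eqxx mulr0.
  by rewrite mul0r.
apply: eq_bigr => k _; rewrite mxE; have [<-|/oA ->] := c1 i =P c1 k.
  by case: eqP ne.
by rewrite !mul0r.
Qed.

Lemma off_partMr (R : nzRingType) c1 c2 (A X : 'M[R]_n) : on_blocks c2 c2 A ->
  off_part c1 c2 (X *m A) = off_part c1 c2 X *m A.
Proof.
move=> oA; apply/matrixP => i j; rewrite !mxE; case: eqP => [e|ne].
  rewrite big1 // => k _; rewrite mxE; have [e'|/oA ->] := c2 k =P c2 j.
    by rewrite e e' eqxx mul0r.
  by rewrite mulr0.
apply: eq_bigr => k _; rewrite mxE; have [->|/oA ->] := c2 k =P c2 j.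
  by case: eqP ne.
by rewrite !mulr0.
Qed.

Lemma off_mull (R : nzRingType) c1 c2 (A X : 'M[R]_n) :
  on_blocks c1 c1 A -> off_blocks c1 c2 X -> off_blocks c1 c2 (A *m X).
Proof. by move=> oA oX; rewrite -(off_part_id oX) -off_partMl //; apply: off_partP. Qed.

Lemma off_mulr (R : nzRingType) c1 c2 (A X : 'M[R]_n) :
  on_blocks c2 c2 A -> off_blocks c1 c2 X -> off_blocks c1 c2 (X *m A).
Proof. by move=> oA oX; rewrite -(off_part_id oX) -off_partMr //; apply: off_partP. Qed.

End Blocks.

(** * Normal forms and the Sylvester equation *)

Section NormalForm.
Variables (F : fieldType) (n : nat).
Implicit Types (w : 'I_n -> {poly F}) (N : 'M[F]_n).

(** A normal form with its block structure flattened: w i is the polar part at the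
    diagonal position i, and N collects the nilpotent parts. *)
Definition normal_mx (K : fieldType) (iota : F -> K) (t : K) w N : 'M[K]_n :=
  diag_mx (\row_i (map_poly iota (w i)).[t^-1]) + t^-1 *: map_mx iota N.

(** The terms t^-j with j >= 2 of a polar part: those that count for the exponential
    parts. *)
Definition irregular (p : {poly F}) : {poly F} := drop_poly 2 p.

(** What remains of the block structure after flattening: N only links positions
    that have the same exponential part. *)
Definition compatible w N : Prop := on_blocks (irregular \o w) (irregular \o w) N.

Lemma normal_mx_on_blocks (K : fieldType) (iota : {rmorphism F -> K}) (t : K) w N :
  compatible w N -> on_blocks (@irregular \o w) (@irregular \o w) (normal_mx iota t w N).
Proof.
move=> cN i j ne; rewrite /normal_mx !mxE (cN _ _ ne) rmorph0 mulr0.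
by have [e|] := i =P j; [rewrite e in ne | rewrite addr0 mulr0n].
Qed.

Fact lconst_additive : zmod_morphism (@lconst F).
Proof. by move=> x y; rewrite /lconst raddfB tofracB. Qed.
Fact lconst_multiplicative : monoid_morphism (@lconst F).
Proof. by split=> [|x y]; rewrite /lconst ?rmorph1 ?rmorphM. Qed.
HB.instance Definition _ := GRing.isZmodMorphism.Build
  F (laurent F) (@lconst F) lconst_additive.
HB.instance Definition _ := GRing.isMonoidMorphism.Build
  F (laurent F) (@lconst F) lconst_multiplicative.

(** If p has a term t^-j with j >= 2 then t p(t^-1) has a pole, so that its
    inverse is a power series without constant term.  This is the gain of one
    power of t that makes the Sylvester operator contracting. *)
Lemma polar_inverse (p : {poly F}) : irregular p != 0 ->
  exists u : {fps F}, fcoef u 0 = 0 /\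
    u%:F * (lvar F * (map_poly (@lconst F) p).[(lvar F)^-1]) = 1.
Proof.
move=> p0; have sp : (2 < size p)%N.
  by rewrite ltnNge; apply: contra p0 => /drop_poly_eq0 e; rewrite /irregular e.
case sz : (size p) sp => [|[|d]] // sd; rewrite ltnS in sd.
pose v : {fps F} := \sum_(i < d.+2) fpsC p`_i * fpsX ^+ (d.+1 - i).
have t0 := lvar_neq0 F.
have ev : v%:F = lvar F ^+ d.+1 * (map_poly (@lconst F) p).[(lvar F)^-1].
  rewrite (@horner_coef_wide _ d.+2) ?size_map_poly ?sz // mulr_sumr rmorph_sum.
  apply: eq_bigr => i _; rewrite coef_map /= tofracM tofracXn mulrCA; congr (_ * _).
  have le : (i <= d.+1)%N by rewrite -ltnS.
  by rewrite -[X in _ = _ ^+ X * _](subnK le) exprD exprVn mulfK ?expf_neq0.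
have uv : v \is a GRing.unit.
  apply: fps_unit_coef0; rewrite fcoef_sum.
  under eq_bigr do rewrite fcoefCM -[fpsX ^+ _]mulr1 fcoefXnM subn_gt0.
  rewrite big_ord_recr /= ltnn mulr1 big1 => [|i _].
    rewrite add0r -[d.+1]/d.+2.-1 -sz -lead_coefE.
    by rewrite lead_coef_eq0 -size_poly_eq0 sz.
  by rewrite ltn_ord mulr0.
exists (fpsX ^+ d * v^-1); split.
  by rewrite fcoefXnM -ltnS sd.
have -> : (fpsX ^+ d * v^-1)%:F * (lvar F * (map_poly (@lconst F) p).[(lvar F)^-1])
   = v^-1%:F * v%:F.
  by rewrite ev tofracM tofracXn -/(lvar F) exprS; ring.
by rewrite -tofracM mulVr.
Qed.
End NormalForm.

Lemma deriv_pole (K : fieldType) (d : {additive K -> K}) (t : K) r :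
  leibniz d -> t != 0 -> d t = 1 ->
  d (t ^+ r)^-1 = - r%:R * (t ^+ r.+1)^-1.
Proof.
move=> dL t0 dt; rewrite leibnizV ?expf_neq0 // leibnizX //= dt mulr1.
case: r => [|r]; first by rewrite !mul0r oppr0 !mul0r.
rewrite !exprS /=; set z := t ^+ r; have z0 : z != 0 by rewrite expf_neq0.
by field; rewrite t0 z0.
Qed.

Lemma mx_entryBD (V : zmodType) m n (A B C : 'M[V]_(m, n)) i j :
  (A - B + C) i j = A i j - B i j + C i j.
Proof. by rewrite !mxE. Qed.

Section Residual.
Variables (F : fieldType) (K : fieldType) (emb : {rmorphism {fps F} -> K}).
Variables (d : {additive K -> K}) (t : K) (iota : {rmorphism F -> K}).
Hypotheses (dL : leibniz d) (embD : forall f, d (emb f) = emb (fps_deriv f)).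
Hypotheses (embX : emb fpsX = t) (embC : forall c, emb (fpsC c) = iota c).
Hypothesis (t0 : t != 0).
Variable n : nat.
Implicit Types (N : 'M[F]_n) (w : 'I_n -> {poly F}) (G X : 'M[{fps F}]_n).

(** What becomes of the equation X' = D1 X - X D2 + G once X and G are replaced by
    t^-r X and t^-r G, everything is multiplied by t^(r + 1), and the terms in
    w1 and w2 are moved to the other side: an operator on power series that
    does not lower the order in t. *)
Definition euler_op r N1 N2 G X : 'M[{fps F}]_n :=
  fpsX *: map_mx (@fps_deriv F) X - X *+ r - map_mx (@fpsC F) N1 *m X
    + X *m map_mx (@fpsC F) N2 - fpsX *: G.

Lemma mx_coef_euler_op r N1 N2 G X k : mx_coef k (euler_op r N1 N2 G X) =
  mx_coef k X *+ k - mx_coef k X *+ r - N1 *m mx_coef k X + mx_coef k X *m N2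
    - mx_coef k (fpsX *: G).
Proof.
have e : mx_coef k (fpsX *: map_mx (@fps_deriv F) X) = mx_coef k X *+ k.
  rewrite mx_coefXM; case: k => [|k]; first by rewrite mulr0n.
  by apply/matrixP => i j; rewrite mulmxnE !mxE.
rewrite -e -(mx_coefCM k N1 X) -(mx_coefMC k X N2).
rewrite /euler_op; move: (fpsX *: G) (fpsX *: map_mx _ X) (_ *m X) (X *m _).
move=> Z1 Z2 Z3 Z4; apply/matrixP => i j.
by rewrite !(mxE, mulmxnE) /coef_at /= fcoefMn.
Qed.

(** The Sylvester equation at the position (i, j) holds if and only if
    [euler_op] equals t (w1 i - w2 j) X, read at that position. *)
Lemma sylvester_residual r w1 w2 N1 N2 G X i j :
  let Y := (t ^+ r)^-1 *: map_mx emb X in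
  d (Y i j) - (normal_mx iota t w1 N1 *m Y - Y *m normal_mx iota t w2 N2
      + (t ^+ r)^-1 *: map_mx emb G) i j =
    (t ^+ r.+1)^-1 * (emb (euler_op r N1 N2 G X i j)
       - t * (map_poly iota (w1 i - w2 j)).[t^-1] * emb (X i j)).
Proof.
have dt : d t = 1.
  rewrite -embX embD -(rmorph1 emb); congr (emb _).
  by apply: fpsP => -[|k] /=; rewrite ?mul0rn.
have ea : (t ^+ r)^-1 = t * (t ^+ r.+1)^-1 by rewrite exprS invfM mulVKf.
have eC N : map_mx iota N = map_mx emb (map_mx (@fpsC F) N).
  by apply/matrixP => k l; rewrite !mxE.
have eN1 : t^-1 *: map_mx iota N1 *m ((t ^+ r)^-1 *: map_mx emb X)
    = (t ^+ r.+1)^-1 *: map_mx emb (map_mx (@fpsC F) N1 *m X).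
  by rewrite -scalemxAl -scalemxAr scalerA -invfM -exprS eC map_mxM.
have eN2 : ((t ^+ r)^-1 *: map_mx emb X) *m (t^-1 *: map_mx iota N2)
    = (t ^+ r.+1)^-1 *: map_mx emb (X *m map_mx (@fpsC F) N2).
  by rewrite -scalemxAl -scalemxAr scalerA -invfM -exprSr eC map_mxM.
have eY : ((t ^+ r)^-1 *: map_mx emb X) i j = (t ^+ r)^-1 * emb (X i j).
  by rewrite !mxE.
rewrite /= [X in d X]eY dL deriv_pole // embD.
rewrite /normal_mx mulmxDl mulmxDr mul_diag_mx mul_mx_diag eN1 eN2.
rewrite /euler_op; set Z1 := _ *m X; set Z2 := X *m _.
rewrite raddfB /= hornerD hornerN.
set p1 := (map_poly _ (w1 i)).[_]; set p2 := (map_poly _ (w2 j)).[_].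
rewrite !mxE -/p1 -/p2 mulmxnE !(rmorphB emb, rmorphD emb, rmorphM emb, rmorphMn emb) embX /= ea.
move: (emb _) (emb _) (emb _) (emb _) (emb _) => x1 x2 x3 x4 x5.
ring.
Qed.
End Residual.

Section Sylvester.
Variables (F : fieldType) (n : nat) (w1 w2 : 'I_n -> {poly F}) (N1 N2 : 'M[F]_n).
Hypotheses (cN1 : compatible w1 N1) (cN2 : compatible w2 N2).
Let c1 := @irregular F \o w1.
Let c2 := @irregular F \o w2.
Let D1 := normal_mx (@lconst F) (lvar F) w1 N1.
Let D2 := normal_mx (@lconst F) (lvar F) w2 N2.
Let toL (X : 'M[{fps F}]_n) : 'M[laurent F]_n := map_mx (@FracField.tofrac _) X.

(* The factor of X in [sylvester_residual]. *)
Let ratio i j : laurent F :=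
  lvar F * (map_poly (@lconst F) (w1 i - w2 j)).[(lvar F)^-1].

Let inverse_ratio : exists u : 'I_n -> 'I_n -> {fps F}, forall i j,
  [/\ fcoef (u i j) 0 = 0, c1 i = c2 j -> u i j = 0 &
      c1 i <> c2 j -> (u i j)%:F * ratio i j = 1].
Proof.
have /choice[u uP] : forall ij : 'I_n * 'I_n, exists u : {fps F},
  [/\ fcoef u 0 = 0, c1 ij.1 = c2 ij.2 -> u = 0 &
      c1 ij.1 <> c2 ij.2 -> u%:F * ratio ij.1 ij.2 = 1].
  move=> [i j] /=; have [e|ne] := c1 i =P c2 j; first by exists 0.
  have [|u [u0 uE]] := @polar_inverse F (w1 i - w2 j); last by exists u.
  by rewrite /irregular raddfB /= subr_eq0; apply/eqP.
by exists (fun i j => u (i, j)) => i j; apply: (uP (i, j)).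
Qed.

Section Solution.
Variable u : 'I_n -> 'I_n -> {fps F}.
Hypothesis uP : forall i j, [/\ fcoef (u i j) 0 = 0, c1 i = c2 j -> u i j = 0 &
      c1 i <> c2 j -> (u i j)%:F * ratio i j = 1].

(* Off the blocks the equation [euler_op] = [ratio] * X is solved for X on the
   right; on the blocks u vanishes, which forces X to vanish there. *)
Let Psi r G X : 'M[{fps F}]_n :=
  \matrix_(i, j) (u i j * euler_op r N1 N2 G X i j).

Let PsiE r G X i j : Psi r G X i j = u i j * euler_op r N1 N2 G X i j.
Proof. by rewrite /Psi mxE. Qed.

Let Psi_ctr r G : mx_contracting (Psi r G).
Proof.
move=> k X Y XY; apply/matrixP => i j.
have coefPsi Z : mx_coef k (Psi r G Z) i j = \sum_(l < k)
    fcoef (u i j) (bump 0 l) * mx_coef (k - bump 0 l) (euler_op r N1 N2 G Z) i j.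
  rewrite mx_coefE PsiE fcoefM big_ord_recl; have [-> _ _] := uP i j.
  by rewrite mul0r add0r; apply: eq_bigr => l _; rewrite mx_coefE.
apply: etrans (coefPsi X) _; apply: etrans _ (esym (coefPsi Y)).
apply: eq_bigr => l _.
have lk : (k - bump 0 l < k)%N by rewrite ltn_subrL (leq_ltn_trans _ (ltn_ord l)).
apply: (congr1 (fun M : 'M_n => fcoef (u i j) (bump 0 l) * M i j)).
apply: etrans (mx_coef_euler_op _ _ _ _ X _) _.
apply: etrans _ (esym (mx_coef_euler_op _ _ _ _ Y _)).
by rewrite (XY _ lk).
Qed.

Let residual r G X i j :
  let Y := (lvar F ^+ r)^-1 *: toL X in
  lderiv (Y i j) - (D1 *m Y - Y *m D2 + (lvar F ^+ r)^-1 *: toL G) i j =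
    (lvar F ^+ r.+1)^-1 * ((euler_op r N1 N2 G X i j)%:F - ratio i j * (X i j)%:F).
Proof.
exact: (@sylvester_residual F (laurent F) (@FracField.tofrac _) (@lderiv F)
  (lvar F) (@lconst F) (@lderiv_leibniz F) (@lderiv_tofrac F) erefl
  (fun=> erefl) (lvar_neq0 F)).
Qed.

Let fixpoint_off r G X : Psi r G X = X -> off_blocks c1 c2 X.
Proof. by move=> <- i j e; rewrite PsiE; have [_ /(_ e) -> _] := uP i j; rewrite mul0r. Qed.

Let off_eq r G X i j : c1 i <> c2 j ->
  let Y := (lvar F ^+ r)^-1 *: toL X in
  (lderiv (Y i j) = (D1 *m Y - Y *m D2 + (lvar F ^+ r)^-1 *: toL G) i j) <->
  Psi r G X i j = X i j.
Proof.
move=> ne Y; have [_ _ /(_ ne) uE] := uP i j.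
have := residual r G X i j; rewrite -/Y => res.
have h0 : (lvar F ^+ r.+1)^-1 != 0 by rewrite invr_eq0 expf_neq0 // lvar_neq0.
have u0 : (u i j)%:F != 0 by apply/eqP => u0; move/eqP: uE; rewrite u0 mul0r eq_sym oner_eq0.
rewrite PsiE; split=> [/eqP|PX].
  rewrite -subr_eq0 res mulf_eq0 (negPf h0) /= subr_eq0 => /eqP e.
  by apply/eqP; rewrite -tofrac_eq tofracM e mulrA uE mul1r.
apply/eqP; rewrite -subr_eq0 res mulf_eq0 (negPf h0) /= subr_eq0.
by apply/eqP/(mulfI u0); rewrite mulrA uE mul1r -tofracM PX.
Qed.

Lemma sylvester_solvable_of (G : 'M[laurent F]_n) : exists X : 'M[laurent F]_n,
  off_blocks c1 c2 X /\
  map_mx (@lderiv F) X = D1 *m X - X *m D2 + off_part c1 c2 G.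
Proof.
have [r [G' eG]] := laurent_mx_pole (off_part c1 c2 G).
have [X PX] := mx_contracting_fix (Psi_ctr r G').
have offX : off_blocks c1 c2 ((lvar F ^+ r)^-1 *: toL X).
  by move=> i j e; rewrite !mxE (fixpoint_off PX e) tofrac0 mulr0.
exists ((lvar F ^+ r)^-1 *: toL X); split=> //; apply/matrixP => i j.
rewrite mxE; have [e|ne] := c1 i =P c2 j; last first.
  by rewrite eG; apply/(off_eq _ _ _ ne); rewrite PX.
have oD1 : on_blocks c1 c1 D1 by apply: normal_mx_on_blocks.
have oD2 : on_blocks c2 c2 D2 by apply: normal_mx_on_blocks.
set Y := _ *: _ in offX *; rewrite (offX _ _ e) raddf0.
have := off_mull oD1 offX e; have := off_mulr oD2 offX e.
have := off_partP (c1 := c1) (c2 := c2) G e.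
set Z1 := _ *m Y; set Z2 := Y *m _; set Z3 := off_part _ _ _ => e3 e2 e1.
by rewrite mx_entryBD e1 e2 e3 subr0 addr0.
Qed.

Lemma sylvester_unique_of (X : 'M[laurent F]_n) : off_blocks c1 c2 X ->
  map_mx (@lderiv F) X = D1 *m X - X *m D2 -> X = 0.
Proof.
have [r [X' ->]] := laurent_mx_pole X; move=> offX eX.
have t0 : (lvar F ^+ r)^-1 != 0 by rewrite invr_eq0 expf_neq0 // lvar_neq0.
suff -> : X' = 0 by apply/matrixP => i j; rewrite !mxE tofrac0 mulr0.
have Psi0 : Psi r 0 0 = 0.
  apply/matrixP => i j; rewrite PsiE /euler_op !(mulmx0, mul0mx, scaler0, mul0rn).
  rewrite (_ : map_mx _ 0 = 0); last by apply: raddf0.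
  by rewrite scaler0 addr0 !subr0 mxE mulr0.
apply: (mx_contracting_unique (Psi_ctr r 0)) Psi0.
apply/matrixP => i j; have [e|ne] := c1 i =P c2 j; last first.
  apply/(off_eq _ _ _ ne); move/matrixP/(_ i j): eX; rewrite [LHS]mxE => ->.
  rewrite (_ : toL 0 = 0); last by apply: raddf0.
  by rewrite scaler0 addr0.
rewrite PsiE; have [_ /(_ e) -> _] := uP i j; rewrite mul0r.
have /eqP := offX _ _ e; rewrite 2!mxE mulf_eq0 (negPf t0) /= tofrac_eq0.
by move=> /eqP.
Qed.
End Solution.

(** Off the blocks w1 i - w2 j has a pole of order at least 2 and dominates all
    other terms, so the equation is a contracting fixed point problem. *)
Lemma sylvester_solvable (G : 'M[laurent F]_n) : exists X : 'M[laurent F]_n,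
  off_blocks c1 c2 X /\
  map_mx (@lderiv F) X = D1 *m X - X *m D2 + off_part c1 c2 G.
Proof. by have [u uP] := inverse_ratio; apply: sylvester_solvable_of uP G. Qed.

(** A solution of the homogeneous equation is a fixed point of the same
    contraction, and so is zero. *)
Lemma sylvester_unique (X : 'M[laurent F]_n) : off_blocks c1 c2 X ->
  map_mx (@lderiv F) X = D1 *m X - X *m D2 -> X = 0.
Proof. by have [u uP] := inverse_ratio; apply: sylvester_unique_of uP X. Qed.
End Sylvester.

(** * Intertwiners over a power series ring *)

Lemma map_leibnizM (R : comNzRingType) (d : {additive R -> R}) m n p
    (A : 'M[R]_(m, n)) (B : 'M[R]_(n, p)) : leibniz d ->
  map_mx d (A *m B) = map_mx d A *m B + A *m map_mx d B.
Proof.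
move=> dL; apply/matrixP => i j; rewrite !mxE raddf_sum -big_split /=.
by apply: eq_bigr => k _; rewrite dL !mxE.
Qed.

Section Agree.
Variables (R : comNzRingType) (n : nat).
Implicit Types X Y : 'M[{fps R}]_n.

(** The operator of [block_gauge] is contracting because it is built from matrix
    operations that respect agreement of the first k coefficients. *)
Lemma mx_agreeD k X X' Y Y' :
  mx_agree k X X' -> mx_agree k Y Y' -> mx_agree k (X + Y) (X' + Y').
Proof. by move=> eX eY l lk; rewrite !mx_coefD eX // eY. Qed.

Lemma mx_agreeB k X X' Y Y' :
  mx_agree k X X' -> mx_agree k Y Y' -> mx_agree k (X - Y) (X' - Y').
Proof. by move=> eX eY l lk; rewrite !mx_coefB eX // eY. Qed.

Lemma mx_agreeM k X X' Y Y' :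
  mx_agree k X X' -> mx_agree k Y Y' -> mx_agree k (X *m Y) (X' *m Y').
Proof.
move=> eX eY l lk; rewrite !mx_coefM; apply: eq_bigr => i _.
by rewrite eX ?eY // (leq_ltn_trans _ lk) ?leq_subr // -ltnS.
Qed.

Lemma mx_agree_on_part (C : eqType) (c1 c2 : 'I_n -> C) k X Y :
  mx_agree k X Y -> mx_agree k (on_part c1 c2 X) (on_part c1 c2 Y).
Proof. by move=> eX l lk; rewrite /mx_coef -!on_part_map -!/(mx_coef l _) eX. Qed.
End Agree.

Section Const.
Variable R : comNzRingType.
Definition const_term (f : {fps R}) : R := fcoef f 0.
Fact const_term_additive : zmod_morphism const_term. Proof. by []. Qed.
Fact const_term_multiplicative : monoid_morphism const_term.
Proof. by split=> // f g; rewrite /const_term fcoefM big_ord1. Qed.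
HB.instance Definition _ := GRing.isZmodMorphism.Build
  {fps R} R const_term const_term_additive.
HB.instance Definition _ := GRing.isMonoidMorphism.Build
  {fps R} R const_term const_term_multiplicative.
End Const.

Lemma unitmx_const_term (K : fieldType) n (P : 'M[{fps K}]_n) :
  mx_coef 0 P \in unitmx -> P \in unitmx.
Proof.
rewrite !unitmxE => uP; apply: fps_unit_coef0.
by rewrite -[fcoef _ 0]/(const_term _) -det_map_mx -unitfE.
Qed.

(** The field K with derivation d plays the role of F((t)); the derivation of
    K[[x]] is d on coefficients, so x is a constant.  D1 and D2 are block diagonal
    for the labels c1 and c2, and the two facts about Sylvester equations are
    taken as hypotheses. *)
Section BlockReduction.
Variables (K : fieldType) (d : {additive K -> K}) (n : nat) (C : eqType).
Variables (c1 c2 : 'I_n -> C) (D1 D2 : 'M[K]_n).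
Hypotheses (dL : leibniz d) (onD1 : on_blocks c1 c1 D1) (onD2 : on_blocks c2 c2 D2).
Hypothesis solvable : forall G : 'M[K]_n, exists X : 'M[K]_n, off_blocks c1 c1 X /\
  map_mx d X = D1 *m X - X *m D1 + off_part c1 c1 G.
Hypothesis unique : forall X : 'M[K]_n, off_blocks c1 c2 X ->
  map_mx d X = D1 *m X - X *m D2 -> X = 0.
Implicit Types (A V W P Q : 'M[{fps K}]_n).

Let deltaM (X : 'M[{fps K}]_n) : 'M[{fps K}]_n := map_mx (fps_map d) X.
Let constM (D : 'M[K]_n) : 'M[{fps K}]_n := map_mx (@fpsC K) D.

Let mx_coef_delta k (X : 'M[{fps K}]_n) : mx_coef k (deltaM X) = map_mx d (mx_coef k X).
Proof. by apply/matrixP => i j; rewrite !mxE. Qed.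

(** With A = D1 + x B, P = 1 + Q and T = B + B Q, the choice
    A' = D1 + x (on-block part of T) turns P' = A P - P A' into
    Q' = D1 Q - Q D1 + x (off-block part of T - Q (on-block part of T)), provided that Q is
    off the blocks.  The coefficient of x^(k + 1) of Q solves a Sylvester equation
    whose right-hand side involves the coefficients up to x^k only. *)
Lemma block_gauge A : mx_coef 0 A = D1 -> exists P A',
  [/\ P \in unitmx, on_blocks c1 c1 A', mx_coef 0 A' = D1
    & deltaM P = A *m P - P *m A'].
Proof.
move=> A0; have /choice[s sP] := solvable.
pose B : 'M[{fps K}]_n := \matrix_(i, j) Fps (fun k => fcoef (A i j) k.+1).
have eA : A = constM D1 + fpsX *: B.
  apply: mx_coefP => k; rewrite mx_coefD mx_coefXM -A0.
  by case: k => [|k]; apply/matrixP => i j; rewrite !mxE ?addr0 ?add0r.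
pose T Q := B + B *m Q.
pose H Q := T Q - Q *m on_part c1 c1 (T Q).
pose Psi Q : 'M[{fps K}]_n := \matrix_(i, j)
  Fps (fun k => if k is l.+1 then s (mx_coef l (H Q)) i j else 0).
have coefPsi k Q : mx_coef k (Psi Q) = if k is l.+1 then s (mx_coef l (H Q)) else 0.
  by apply/matrixP => i j; rewrite !mxE /coef_at /=; case: k => [|k]; rewrite ?mxE.
have ctr : mx_contracting Psi.
  move=> k Q Q' QQ'; apply: etrans (coefPsi k Q) _.
  apply: etrans _ (esym (coefPsi k Q')); case: k QQ' => [//|k] QQ'; apply: (congr1 s).
  have TT : mx_agree k.+1 (T Q) (T Q').
    by apply: mx_agreeD => //; apply: mx_agreeM.
  exact: (mx_agreeB TT (mx_agreeM QQ' (mx_agree_on_part c1 c1 TT)) (ltnSn k)).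
have [Q PQ] := mx_contracting_fix ctr.
have coefQ k : mx_coef k Q = if k is l.+1 then s (mx_coef l (H Q)) else 0.
  by rewrite -{1}PQ coefPsi.
have offQ : off_blocks c1 c1 Q.
  move=> i j e; apply: fpsP => k; rewrite -mx_coefE coefQ; case: k => [|k].
    by rewrite mxE.
  by have [-> //] := sP (mx_coef k (H Q)).
have dQ : deltaM Q = constM D1 *m Q - Q *m constM D1 + fpsX *: off_part c1 c1 (H Q).
  apply: mx_coefP => k; rewrite mx_coef_delta mx_coefD mx_coefB mx_coefCM mx_coefMC.
  rewrite mx_coefXM coefQ; case: k => [|k].
    by rewrite mulmx0 mul0mx subr0 addr0 raddf0.
  by have [_ ->] := sP (mx_coef k (H Q)); rewrite [in LHS]/mx_coef off_part_map.
pose A' := constM D1 + fpsX *: on_part c1 c1 (T Q).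
exists (1%:M + Q), A'; split.
- apply: unitmx_const_term; rewrite mx_coefD coefQ addr0.
  rewrite (_ : mx_coef 0 1%:M = 1%:M) ?unitmx1 //.
  exact: (map_mx1 (@const_term K)).
- move=> i j ne; rewrite !mxE onD1 // raddf0 add0r.
  by case: eqP ne => // _ _; rewrite mulr0.
- rewrite /A' mx_coefD mx_coefXM addr0.
  by apply/matrixP => i j; rewrite !mxE.
rewrite /deltaM raddfD /= -/(deltaM Q) dQ.
have -> : map_mx (fps_map d) 1%:M = 0 :> 'M_n.
  apply/matrixP => i j; rewrite !mxE.
  have d1 : fps_map d 1 = 0.
    by apply: (@leibniz1 _ (fps_map d)); apply: fps_map_leibniz.
  by case: eqP => _; rewrite ?mulr1n ?d1 // raddf0.
have -> : off_part c1 c1 (H Q) = off_part c1 c1 (T Q) - Q *m on_part c1 c1 (T Q).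
  rewrite /H raddfB /=; congr (_ - _); apply: off_part_id.
  by apply: off_mulr => //; apply: on_partP.
rewrite add0r {1}eA /A' !mulmxDr !mulmxDl !mulmx1 !mul1mx -!scalemxAl -!scalemxAr.
have -> : off_part c1 c1 (T Q) = T Q - on_part c1 c1 (T Q).
  by rewrite -{2}(on_off_part c1 c1 (T Q)) addrAC subrr add0r.
rewrite {1}/T !scalerBr !scalerDr.
move: (constM D1) (constM D1 *m Q) (Q *m constM D1) (fpsX *: B) (fpsX *: (B *m Q)).
move: (fpsX *: on_part _ _ _) (fpsX *: (Q *m _)) => x1 x2 x3 x4 x5 x6 x7.
by apply/matrixP => i j; rewrite !mxE; ring.
Qed.

(** The off-block part of W satisfies the same equation as W.  Its first nonzero
    coefficient would solve the homogeneous Sylvester equation. *)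
Lemma intertwiner_on A W : on_blocks c1 c1 A -> mx_coef 0 A = D1 ->
  deltaM W = A *m W - W *m constM D2 -> on_blocks c1 c2 W.
Proof.
move=> onA A0 dW; pose Z := off_part c1 c2 W.
have onC : on_blocks c2 c2 (constM D2).
  by move=> i j ne; rewrite mxE onD2 // raddf0.
have dZ : deltaM Z = A *m Z - Z *m constM D2.
  rewrite /deltaM -off_part_map -/(deltaM W) dW raddfB /=.
  exact: (congr2 (fun X Y => X - Y) (off_partMl c2 W onA) (off_partMr c1 W onC)).
have Z0 : Z = 0.
  apply: mx_coefP => k; rewrite [RHS](_ : _ = 0); last first.
    by apply/matrixP => i j; rewrite !mxE.
  elim/ltn_ind: k => k IHk; apply: unique.
    by rewrite /mx_coef -off_part_map; apply: off_partP.
  have := congr1 (mx_coef k) dZ; rewrite mx_coef_delta => ->.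
  rewrite mx_coefB mx_coefMC mx_coefM big_ord_recl.
  rewrite A0 subn0 big1 ?addr0 // => i _; rewrite IHk ?mulmx0 //.
  by rewrite ltn_subrL (leq_ltn_trans _ (ltn_ord i)).
by rewrite -(on_off_part c1 c2 W) -/Z Z0 addr0; apply: on_partP.
Qed.

(** Some term of the expansion of the determinant over permutations is nonzero,
    and all the entries in it are on blocks. *)
Lemma det_on_blocks W : on_blocks c1 c2 W -> \det W != 0 ->
  exists s : 'S_n, forall i, c1 i = c2 (s i).
Proof.
move=> onW; have [[s sP] _|nos /eqP[]] := pselect (exists s : 'S_n, forall i, c1 i = c2 (s i)).
  by exists s.
rewrite /determinant big1 // => s _.
have [i ne] : exists i, c1 i <> c2 (s i).
  by apply: contrapT => ni; apply: nos; exists s => i; apply: contrapT => ne; apply: ni; exists i.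
by rewrite (bigD1 i) //= onW // mul0r mulr0.
Qed.

(** The constant term of V may be singular; nevertheless V, which is invertible over
    the fraction field, forces the labels to match. *)
Lemma intertwiner_perm A V : mx_coef 0 A = D1 ->
  deltaM V = A *m V - V *m constM D2 -> \det V != 0 ->
  exists s : 'S_n, forall i, c1 i = c2 (s i).
Proof.
move=> A0 dV V0; have [P [A' [uP onA' A'0 dP]]] := block_gauge A0.
have [W eV] : exists W, V = P *m W by exists (invmx P *m V); rewrite mulKVmx.
have dW : deltaM W = A' *m W - W *m constM D2.
  apply: (can_inj (mulKmx uP)).
  have := dV; rewrite {1}eV /deltaM map_leibnizM; last exact: fps_map_leibniz.
  rewrite -/(deltaM P) -/(deltaM W) dP => /(canRL (addKr _)) ->.
  rewrite eV mulmxBl mulmxBr !mulmxA.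
  move: (A *m P *m W) (P *m A' *m W) (P *m W *m constM D2) => X Y Z.
  by rewrite opprB addrA subrK.
have onW := intertwiner_on onA' A'0 dW.
by apply: (det_on_blocks onW); apply: contraNneq V0; rewrite eV det_mulmx => ->; rewrite mulr0.
Qed.
End BlockReduction.

(** * Flattening and ramifying normal forms *)

Lemma perm_enum_blocks (T : eqType) m (bd : 'I_m -> nat) (f : 'I_m -> T) :
  perm_eq (flatten [seq nseq (bd k) (f k) | k <- enum 'I_m])
    [seq f (tagnat.sig1 i) | i <- enum 'I_(\sum_k bd k)].
Proof.
apply/seq.permP => P; rewrite count_flatten -map_comp count_map sumnE big_map.
rewrite -sumn_count sumnE big_map !big_enum /=.
pose G (k : 'I_m) (j : 'I_(bd k)) : nat := P (f k).
transitivity (\sum_k \sum_j G k j)%N.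
  by apply: eq_bigr => k _; rewrite count_nseq sum_nat_const card_ord mulnC.
by rewrite sig_big_dep (reindex _ tagnat.sig_bij_on) /=; apply: eq_bigr.
Qed.

(** The flattened data serve all embeddings of the constants at once, and yield the
    list of exponential parts with the right multiplicities. *)
Lemma block_diag_normal (F : fieldType) n (s : block_shape n)
    (w : 'I_(nblocks s) -> {poly F}) (N : forall k, 'M[F]_(bdim s k)) :
    (forall k, polar_part (w k)) ->
  exists (wf : 'I_n -> {poly F}) (Nf : 'M[F]_n),
    [/\ compatible wf Nf, forall i, polar_part (wf i),
        forall (K : fieldType) (iota : {rmorphism F -> K}) (t : K),
          block_diag (fun k => exp_block iota t (w k) (N k)) = normal_mx iota t wf Nf
      & forall a, perm_eq (exp_list a w) [seq puiseux_form a (wf i) | i <- enum 'I_n]].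
Proof.
move=> w0; case: s w N w0 => m bd; case: n / => /= w N w0.
exists (fun i => w (tagnat.sig1 i)), (\mxdiag_k N k); split=> //.
- move=> i j ne; rewrite !mxE; case: eqP => [e|_]; last by rewrite mxE.
  by rewrite /= e in ne.
- move=> K iota t; rewrite /block_diag castmx_id.
  apply/matrixP => i j; rewrite !mxE -(can_eq (@tagnat.sigK _ _)) /tagnat.sig1 /tagnat.sig2.
  case: (tagnat.sig i) (tagnat.sig j) => [/= k x] [/= l y].
  case: eqP => [e|nkl]; last first.
    by rewrite !mxE rmorph0 mulr0 addr0; case: eqVneq => // -[].
  by case: _ / e in y *; rewrite !conform_mx_id eq_Tagged /= !mxE.
by move=> a; apply: perm_enum_blocks.
Qed.

(** * Ramification of normal forms *)

Section PolarRamify.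
Variable F : fieldType.
Implicit Types p : {poly F}.

(** The polar part of b t^(b - 1) p(t^-b), into which the substitution of t^b
    for t turns the form p(t^-1) dt. *)
Definition polar_ramify (b : nat) p : {poly F} := b%:R *: ('X * (drop_poly 1 p \Po 'X^b)).

Lemma irregular_ramify b p : (0 < b)%N ->
  irregular (polar_ramify b p) = b%:R *: ('X^(b.-1) * (irregular p \Po 'X^b)).
Proof.
move=> b0; rewrite /irregular /polar_ramify drop_polyZ; congr (_ *: _).
have -> : drop_poly 1 p = (p`_1)%:P + drop_poly 2 p * 'X.
  apply/polyP => -[|i]; rewrite coefD coefC coefMX !coef_drop_poly ?addr0 ?add0r //=.
  by rewrite addn1 addn2.
rewrite comp_polyD comp_polyC comp_polyM comp_polyX mulrDr drop_polyD.
rewrite drop_poly_eq0 ?add0r; last first.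
  by apply: leq_trans (size_polyMleq _ _) _; rewrite size_polyX add2n /= ltnS size_polyC leq_b1.
have -> : 'X * ((drop_poly 2 p \Po 'X^b) * 'X^b) = 'X^(b.-1) * (drop_poly 2 p \Po 'X^b) * 'X^2.
  by rewrite -(prednK b0) !exprS /=; ring.
by rewrite drop_polyMXn_id.
Qed.

Lemma puiseux_formE a p M r : (size (irregular p) <= M)%N ->
  puiseux_form a p r =
    \sum_(i < M) if r == (1 - i.+2%:R) / a%:R - 1 then (irregular p)`_i / a%:R else 0.
Proof.
move=> sM; rewrite /puiseux_form -(big_mkord xpredT (fun i =>
  if r == (1 - i.+2%:R) / a%:R - 1 then (irregular p)`_i / a%:R else 0)).
rewrite [RHS](@big_cat_nat _ _ _ (size (irregular p))) //=.
rewrite [X in _ + X]big_nat_cond [X in _ + X]big1 => [|i].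
  rewrite addr0 size_drop_poly big_mkcond /= -{1}[2%N]add0n big_addn.
  by apply: eq_bigr => i _; rewrite coef_drop_poly addn2.
by rewrite andbT => /andP[si _]; rewrite nth_default // mul0r if_same.
Qed.

Lemma eq_puiseux a p q : irregular p = irregular q -> puiseux_form a p = puiseux_form a q.
Proof.
move=> e; apply: funext => r.
rewrite (@puiseux_formE _ p (size (irregular p))) //.
by rewrite (@puiseux_formE _ q (size (irregular p))) ?e.
Qed.

(** A term t^-j dt and its image under ramification are the same fractional power
    of the original variable, with the same coefficient. *)
Lemma puiseux_ramify a b p : (0 < a)%N -> (0 < b)%N -> b%:R != 0 :> F ->
  puiseux_form (a * b) (polar_ramify b p) = puiseux_form a p.
Proof.
move=> a0 b0 bF; apply: funext => r.
pose S := size (irregular p).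
rewrite (@puiseux_formE _ p S.+1) // (@puiseux_formE _ _ (b.-1 + (S * b).+1)); last first.
  rewrite irregular_ramify //; apply/leq_sizeP => j lej.
  rewrite coefZ coefXnM coef_comp_poly_Xn //.
  case: ltnP => [|_]; first by rewrite mulr0.
  case: ifP; last by rewrite mulr0.
  move=> dv; rewrite nth_default ?mulr0 // -/S leq_divRL //; lia.
rewrite big_split_ord /= big1 ?add0r => [|i _]; last first.
  by rewrite irregular_ramify // coefZ coefXnM ltn_ord mulr0 mul0r if_same.
pose G i : F := if r == (1 - (b.-1 + i).+2%:R) / (a * b)%:R - 1
  then (irregular (polar_ramify b p))`_(b.-1 + i) / (a * b)%:R else 0.
rewrite (@sum_multiples _ b b0 G) => [|i nb]; last first.
  rewrite /G irregular_ramify // coefZ coefXnM ltnNge leq_addr /= addKn.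
  by rewrite coef_comp_poly_Xn // (negPf nb) mulr0 mul0r if_same.
apply: eq_bigr => i _; rewrite /G irregular_ramify // coefZ coefXnM ltnNge leq_addr /= addKn.
rewrite coef_comp_poly_Xn // dvdn_mull // mulnK //.
have -> : (b.-1 + i * b).+2 = (i.+1 * b).+1 by rewrite mulSn; lia.
have -> : (1 - (i.+1 * b).+1%:R) / (a * b)%:R = (1 - i.+2%:R) / a%:R :> rat.
  have b1 : b%:R != 0 :> rat by rewrite Num.Theory.pnatr_eq0 -lt0n.
  have a1 : a%:R != 0 :> rat by rewrite Num.Theory.pnatr_eq0 -lt0n.
  by rewrite -natr1 !natrM -(natr1 i.+1); field; rewrite a1 b1.
by rewrite natrM invfM [_^-1 * _]mulrC mulrA -[_ * _ / b%:R]mulrAC mulfV // mul1r.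
Qed.

Lemma map_normal_mx n (K K' : fieldType) (u : {rmorphism K -> K'}) (iota : {rmorphism F -> K}) t
    (w : 'I_n -> {poly F}) N :
  map_mx u (normal_mx iota t w N) = normal_mx (u \o iota) (u t) w N.
Proof.
rewrite /normal_mx map_mxD map_mxZ fmorphV -map_mx_comp; congr (_ + _).
apply/matrixP => i j; rewrite !mxE raddfMn /=; congr (_ *+ _).
rewrite map_poly_comp -horner_map /=.
by rewrite fmorphV.
Qed.

(** The factor b t^(b - 1) cancels all but one power of t in t^-b, so the
    ramified matrix is again a normal form, with N multiplied by b. *)
Lemma normal_mx_ramify n (K : fieldType) (iota : {rmorphism F -> K}) t b
    (w : 'I_n -> {poly F}) N : (0 < b)%N -> t != 0 -> (forall i, polar_part (w i)) ->
  (b%:R * t ^+ b.-1) *: normal_mx iota (t ^+ b) w N =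
    normal_mx iota t (fun i => polar_ramify b (w i)) (b%:R *: N).
Proof.
move=> b0 t0 w0; have tb : t ^+ b = t * t ^+ b.-1 by rewrite -exprS prednK.
have tb0 : t ^+ b.-1 != 0 by rewrite expf_neq0.
rewrite /normal_mx scalerDr scalerA; congr (_ + _); last first.
  rewrite map_mxZ scalerA rmorph_nat; congr (_ *: _).
  by rewrite tb; field; rewrite t0 tb0.
apply/matrixP => i j; rewrite !mxE mulrnAr; case: eqP => _; last by rewrite !mulr0n.
rewrite !mulr1n /polar_ramify map_polyZ rmorphM /= map_polyX hornerZ hornerM hornerX rmorph_nat.
rewrite map_comp_poly map_polyXn horner_comp hornerXn.
have {1}-> : w i = drop_poly 1 (w i) * 'X.
  apply/polyP => -[|k]; rewrite coefMX ?coef_drop_poly ?addn1 //=; exact: w0.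
rewrite rmorphM /= map_polyX hornerMX exprVn.
set z := _.[_]; rewrite tb.
by field; rewrite t0 tb0.
Qed.

Lemma compatible_ramify n b (w : 'I_n -> {poly F}) N : (0 < b)%N ->
  compatible w N -> compatible (fun i => polar_ramify b (w i)) (b%:R *: N).
Proof.
move=> b0 cN i j ne; rewrite mxE cN ?mulr0 //; apply: contra_not ne => /= e.
by rewrite !irregular_ramify // e.
Qed.
End PolarRamify.

(** * Transport of gauge equations *)

Lemma gauge_eq (K : fieldType) (d : K -> K) n (T M D : 'M[K]_n) :
  T \in unitmx -> gauge d T M = D -> map_mx d T = M *m T - T *m D.
Proof. by move=> uT <-; rewrite /gauge mulKVmx // opprB addrC subrK. Qed.

(** A field morphism that multiplies the derivation by k maps solutions of a gauge
    equation to solutions of the equation with both matrices scaled by k. *)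
Lemma transport (K K' : fieldType) (d : K -> K) (d' : K' -> K')
    (u : {rmorphism K -> K'}) (k : K') n (T M D : 'M[K]_n) :
    (forall z, d' (u z) = k * u (d z)) -> map_mx d T = M *m T - T *m D ->
  map_mx d' (map_mx u T) =
    (k *: map_mx u M) *m map_mx u T - map_mx u T *m (k *: map_mx u D).
Proof.
move=> du dT; have -> : map_mx d' (map_mx u T) = k *: map_mx u (map_mx d T).
  by apply/matrixP => i j; rewrite !mxE du.
by rewrite dT map_mxB !map_mxM scalerBr scalemxAl scalemxAr.
Qed.

(** A transformation of the constant term to normal form, applied to the whole
    system. *)
Lemma const_gauge (K : fieldType) (d : {additive K -> K}) n (P0 D1 D2 : 'M[K]_n)
    (A V : 'M[{fps K}]_n) : leibniz d ->
    P0 \in unitmx -> map_mx d P0 = mx_coef 0 A *m P0 - P0 *m D1 ->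
    map_mx (fps_map d) V = A *m V - V *m map_mx (@fpsC K) D2 ->
    \det V != 0 ->
  exists A' V', [/\ mx_coef 0 A' = D1, \det V' != 0
    & map_mx (fps_map d) V' = A' *m V' - V' *m map_mx (@fpsC K) D2].
Proof.
move=> dL uP dP dV V0; pose c : 'M_n -> 'M_n := map_mx (@fpsC K).
have uc : c P0 \in unitmx by rewrite /c map_unitmx.
have [V' eV] : exists V', V = c P0 *m V' by exists (invmx (c P0) *m V); rewrite mulKVmx.
exists (c (invmx P0) *m (A *m c P0 - c (map_mx d P0))), V'; split.
- rewrite mx_coefCM mx_coefB mx_coefMC dP; set B := _ *m P0.
  have -> : mx_coef 0 (c (B - P0 *m D1)) = B - P0 *m D1.
    by apply/matrixP => i j; rewrite [LHS]mxE /coef_at mxE.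
  by rewrite opprB addrC subrK mulKmx.
- by apply: contraNneq V0; rewrite eV det_mulmx => ->; rewrite mulr0.
have -> : c (invmx P0) = invmx (c P0) by rewrite /c map_invmx.
apply: (can_inj (mulKmx uc)); move: dV.
rewrite {1}eV map_leibnizM; last exact: fps_map_leibniz.
have -> : map_mx (fps_map d) (c P0) = c (map_mx d P0).
  apply/matrixP => i j; rewrite !mxE; apply: fpsP => k /=.
  by case: eqP => // _; rewrite raddf0.
move=> /(canRL (addKr _)) ->; rewrite eV [RHS]mulmxBr -[in RHS](mulmxA (invmx _)).
rewrite mulKVmx // mulmxBl !mulmxA.
by rewrite addrA [- _ + _]addrC.
Qed.

Section Core.
Variables (F : fieldType) (n : nat) (w1 w2 : 'I_n -> {poly F}) (N1 N2 : 'M[F]_n).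
Hypotheses (cN1 : compatible w1 N1) (cN2 : compatible w2 N2).

Lemma laurent_intertwiner (P0 : 'M[laurent F]_n) (A V : 'M[{fps (laurent F)}]_n) :
    P0 \in unitmx ->
    map_mx (@lderiv F) P0 =
      mx_coef 0 A *m P0 - P0 *m normal_mx (@lconst F) (lvar F) w1 N1 ->
    map_mx (fps_map (@lderiv F)) V =
      A *m V - V *m map_mx (@fpsC (laurent F)) (normal_mx (@lconst F) (lvar F) w2 N2) ->
    \det V != 0 ->
  exists s : 'S_n, forall i, irregular (w1 i) = irregular (w2 (s i)).
Proof.
move=> uP dP dV V0.
have [A' [V' [A'0 V'0 dV']]] := const_gauge (@lderiv_leibniz F) uP dP dV V0.
have [s sE] := intertwiner_perm (@lderiv_leibniz F) (normal_mx_on_blocks (@lconst F) (lvar F) cN1)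
  (normal_mx_on_blocks (@lconst F) (lvar F) cN2) (sylvester_solvable cN1 cN1)
  (@sylvester_unique F n w1 w2 N1 N2) A'0 dV' V'0.
by exists s => i; apply: sE.
Qed.
End Core.

Lemma mx_coef0_scale_map (R S : comNzRingType) (u : {rmorphism R -> S}) (g : S) m n
    (C : 'M[{fps R}]_(m, n)) :
  mx_coef 0 (fpsC g *: map_mx (fps_map u) C) = g *: map_mx u (mx_coef 0 C).
Proof. by apply/matrixP => i j; rewrite mx_coefE mxE fcoefCM !mxE. Qed.

Lemma scale_map_ode (K : fieldType) (ua ub : {rmorphism K -> K}) (t k : K) a b q n
    (X : 'M[K]_n) : ua t = t ^+ a -> ub t = t ^+ b ->
  k *: map_mx ub ((a%:R / t) *: map_mx ua ((t ^+ q)^-1 *: X)) =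
  (k * (a%:R / t ^+ b * ((t ^+ b) ^+ a ^+ q)^-1)) *: map_mx ub (map_mx ua X).
Proof.
move=> et eb; rewrite !map_mxZ !scalerA !fmorphV !rmorphXn et rmorphXn.
by rewrite rmorphM fmorphV rmorph_nat eb !mulrA.
Qed.

(** The factor s is constant for the derivation, so it can be cancelled. *)
Lemma clear_denominator (R : comNzRingType) (K : fieldType) (emb : {rmorphism R -> K})
    (dR : R -> R) (d : K -> K) (s : K) n (A V D : 'M[R]_n) :
    injective emb -> s != 0 -> (forall f, d (s * emb f) = s * emb (dR f)) ->
    map_mx d (s *: map_mx emb V) =
      map_mx emb A *m (s *: map_mx emb V) - (s *: map_mx emb V) *m map_mx emb D ->
  map_mx dR V = A *m V - V *m D.
Proof.
move=> embI s0 dE; rewrite -scalemxAr -scalemxAl -scalerBr -!map_mxM -map_mxB.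
have -> : map_mx d (s *: map_mx emb V) = s *: map_mx emb (map_mx dR V).
  by apply/matrixP => i j; rewrite !mxE.
move=> /(scalerI s0)/matrixP e; apply/matrixP => i j; apply: embI.
by have := e i j; rewrite mxE [RHS]mxE.
Qed.

Lemma morph_scalar (K K' : fieldType) (u : {rmorphism K -> K'}) (k x : K) b m :
  u (k * (b%:R / x * (x ^+ m)^-1)) = u k * (b%:R / u x * (u x ^+ m)^-1).
Proof. by rewrite !rmorphM !fmorphV rmorphXn rmorph_nat. Qed.

(** Ramifying by a and then by b, or in the other order, gives the same scalar
    factor in front of the matrix of the system. *)
Lemma ramified_scalar (K : fieldType) (t : K) a b q : (0 < a)%N -> (0 < b)%N -> t != 0 ->
  (b%:R * t ^+ b.-1) * ((a%:R / t ^+ b) * ((t ^+ b) ^+ a ^+ q)^-1) =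
  (a%:R * t ^+ a.-1) * ((b%:R / t ^+ a) * ((t ^+ a) ^+ (b * q))^-1).
Proof.
move=> a0 b0 t0.
have e m : (0 < m)%N -> t ^+ m = t * t ^+ m.-1 by move=> m0; rewrite -exprS prednK.
have -> : (t ^+ a) ^+ (b * q) = (t ^+ b) ^+ a ^+ q.
  by rewrite exprM [t ^+ a ^+ b]exprAC.
set z := (t ^+ b) ^+ a ^+ q.
have z0 : z != 0 by rewrite !expf_neq0.
rewrite (e a) // (e b) //.
have x0 : t ^+ a.-1 != 0 by rewrite expf_neq0.
have y0 : t ^+ b.-1 != 0 by rewrite expf_neq0.
by field; rewrite t0 x0 y0 z0.
Qed.

Section Ramified.
Variable F : fieldType.

Fact const2_additive : zmod_morphism (@const2 F).
Proof. by move=> x y; rewrite /const2 !raddfB. Qed.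
Fact const2_multiplicative : monoid_morphism (@const2 F).
Proof. by split=> [|x y]; rewrite /const2 ?rmorph1 ?rmorphM. Qed.
HB.instance Definition _ := GRing.isZmodMorphism.Build
  F (laurent2 F) (@const2 F) const2_additive.
HB.instance Definition _ := GRing.isMonoidMorphism.Build
  F (laurent2 F) (@const2 F) const2_multiplicative.

(** The function [lramify a] with its structure of field morphism. *)
Definition lramify_morph a (a0 : (0 < a)%N) : {rmorphism laurent F -> laurent F} :=
  frac_mapm (@fps_ramify_inj F a a0 : injective (ramify_fps (R:=F) a0)).

Lemma lramify_tofrac a (a0 : (0 < a)%N) f : lramify_morph a0 f%:F = (fps_ramify a f)%:F.
Proof. exact: (@frac_map_tofrac _ _ (ramify_fps (R:=F) a0) (@fps_ramify_inj F a a0)). Qed.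

Lemma lramify_lvar a (a0 : (0 < a)%N) : lramify_morph a0 (lvar F) = lvar F ^+ a.
Proof. by rewrite lramify_tofrac fps_ramifyX // tofracXn. Qed.

Lemma lramify_lconst a (a0 : (0 < a)%N) c : lramify_morph a0 (lconst c) = lconst c.
Proof. by rewrite lramify_tofrac fps_ramifyC. Qed.

Lemma lderiv_lramify a (a0 : (0 < a)%N) z :
  lderiv (lramify_morph a0 z) = (a%:R * lvar F ^+ a.-1) * lramify_morph a0 (lderiv z).
Proof.
have := @frac_deriv_map _ _ (@fps_deriv F) (@fps_deriv F) (ramify_fps (R:=F) a0)
  (a%:R * fpsX ^+ a.-1) z (@fps_deriv_leibniz F) (@fps_deriv_leibniz F)
  (@fps_ramify_inj F a a0) (fps_deriv_ramify a0).
by rewrite tofracM tofracXn rmorph_nat.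
Qed.

End Ramified.

(** * Expansion of a bivariate system along the first variable *)

(** The field F((x, y)) is sent into F((t))((x)), where y = t^a.  The expansion
    in powers of x separates the variables: the derivation with respect to t acts
    on coefficients. *)
Section SecondVariable.
Variables (F : fieldType) (a : nat) (a0 : (0 < a)%N).
Local Notation L := (laurent F).
(** The substitution f(y) |-> f(t^a), with values in F((t)). *)
Definition y_subst : {rmorphism {fps F} -> L} :=
  (@FracField.tofrac {fps F}) \o ramify_fps (R:=F) a0.
Lemma y_substE f : y_subst f = (fps_ramify a f)%:F. Proof. by []. Qed.
Definition x_series : {rmorphism {fps {fps F}} -> {fps L}} := fps_map y_subst.
(** The derivative of t^a. *)
Definition chain_factor : L := a%:R * lvar F ^+ a.-1.
Definition x_const : {rmorphism L -> laurent L} := (@FracField.tofrac {fps L}) \o (@fpsC L).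

Lemma y_subst_inj : injective y_subst.
Proof.
move=> f g; rewrite !y_substE => /eqP; rewrite tofrac_eq => /eqP.
exact: fps_ramify_inj.
Qed.

Lemma x_series_inj : injective x_series.
Proof. exact: fps_map_inj y_subst_inj. Qed.

Definition x_laurent : {rmorphism laurent2 F -> laurent L} := frac_mapm x_series_inj.

Lemma x_laurent_tofrac f : x_laurent f%:F = (x_series f)%:F.
Proof. exact: (@frac_map_tofrac _ _ x_series x_series_inj). Qed.

Lemma lderiv_y_subst f : lderiv (y_subst f) = chain_factor * y_subst (fps_deriv f).
Proof.
rewrite /= lderiv_tofrac fps_deriv_ramify // tofracM tofracM tofracXn rmorph_nat.
by [].
Qed.

Lemma deriv_x_series f : fps_map (@lderiv F) (x_series f) =
  fpsC chain_factor * x_series (fps_map (@fps_deriv F) f).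
Proof. by apply: fpsP => k; rewrite fcoefCM /= lderiv_y_subst. Qed.

Lemma deriv_x_laurent z :
  frac_deriv (fps_map (@lderiv F)) (x_laurent z) =
    x_const chain_factor * x_laurent (deriv_y z).
Proof.
exact: (frac_deriv_map _ (fps_map_leibniz (@fps_deriv_leibniz F))
  (fps_map_leibniz (@lderiv_leibniz F)) x_series_inj deriv_x_series).
Qed.

Lemma x_laurent_const c : x_laurent (const2 c) = x_const (lconst c).
Proof.
have e : x_series (fpsC (fpsC c)) = fpsC (lconst c).
  by rewrite [LHS]fps_mapC y_substE fps_ramifyC.
by rewrite x_laurent_tofrac e.
Qed.

Lemma x_laurent_var : x_laurent (var_y F) = x_const (lvar F ^+ a).
Proof.
have e : x_series (fpsC fpsX) = fpsC (lvar F ^+ a).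
  by rewrite [LHS]fps_mapC y_substE fps_ramifyX // tofracXn.
by rewrite x_laurent_tofrac e.
Qed.

Definition x_laurent_deriv : {additive laurent L -> laurent L} :=
  frac_derivm (fps_map_leibniz (@lderiv_leibniz F)).

Lemma x_laurent_deriv_pole m (f : {fps L}) : x_laurent_deriv ((lvar L ^+ m)^-1 * f%:F) =
  (lvar L ^+ m)^-1 * (fps_map (@lderiv F) f)%:F.
Proof.
have fL : leibniz x_laurent_deriv := frac_deriv_leibniz (fps_map_leibniz (@lderiv_leibniz F)).
have ft g : x_laurent_deriv g%:F = (fps_map (@lderiv F) g)%:F.
  exact: (frac_deriv_tofrac (fps_map_leibniz (@lderiv_leibniz F))).
have dt : x_laurent_deriv (lvar L) = 0.
  rewrite ft (_ : fps_map _ _ = 0) ?tofrac0 //; apply: fpsP => k /=.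
  case: (k == 1%N); last exact: raddf0.
  exact: (leibniz1 (@lderiv_leibniz F)).
by rewrite fL ft leibnizV ?expf_neq0 ?lvar_neq0 // leibnizX //= dt mulr0 oppr0 !mul0r add0r.
Qed.

(** C is the numerator of the matrix in the second variable, after the ramification
    y = t2^b; the further substitution t2 = t^a leads to the ramification y = t^(a b).
    Any power of x in the denominators of T is a constant for the derivation and
    can be dropped. *)
Lemma expand_system n (b q : nat) (C : 'M[{fps {fps F}}]_n)
    (w : 'I_n -> {poly F}) (N : 'M[F]_n) (T : 'M[laurent2 F]_n) :
    T \in unitmx -> (forall i, polar_part (w i)) ->
    map_mx (@deriv_y F) T =
      ((b%:R / var_y F) *: ((var_y F ^+ (b * q))^-1 *: map_mx (@FracField.tofrac _) C)) *m T
        - T *m normal_mx (@const2 F) (var_y F) w N ->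
  let A := fpsC (chain_factor * (b%:R / lvar F ^+ a * ((lvar F ^+ a) ^+ (b * q))^-1))
             *: map_mx x_series C in
  exists2 V : 'M[{fps L}]_n, \det V != 0 &
    map_mx (fps_map (@lderiv F)) V =
      A *m V - V *m map_mx (@fpsC L)
        (normal_mx (@lconst F) (lvar F) (fun i => polar_ramify a (w i)) (a%:R *: N)).
Proof.
move=> uT w0 eT A; have dT := transport deriv_x_laurent eT.
have uT' : map_mx x_laurent T \in unitmx by rewrite map_unitmx.
have eM : x_const chain_factor *: map_mx x_laurent ((b%:R / var_y F) *:
    ((var_y F ^+ (b * q))^-1 *: map_mx (@FracField.tofrac _) C)) =
    map_mx (@FracField.tofrac _) A.
  rewrite !map_mxZ !scalerA.
  rewrite (fmorphV x_laurent) (rmorphXn x_laurent) (fmorph_div x_laurent).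
  rewrite (rmorph_nat x_laurent) x_laurent_var.
  have -> : map_mx x_laurent (map_mx (@FracField.tofrac _) C) =
      map_mx (@FracField.tofrac _) (map_mx x_series C).
    by apply/matrixP => i j; rewrite !mxE; apply: x_laurent_tofrac.
  apply: (congr1 (fun x => x *: _)).
  exact: (esym (morph_scalar x_const chain_factor (lvar F ^+ a) b (b * q))).
have eD : x_const chain_factor *: map_mx x_laurent (normal_mx (@const2 F) (var_y F) w N) =
    map_mx (@FracField.tofrac _) (map_mx (@fpsC L)
      (normal_mx (@lconst F) (lvar F) (fun i => polar_ramify a (w i)) (a%:R *: N))).
  have -> : map_mx x_laurent (normal_mx (@const2 F) (var_y F) w N) =
      map_mx x_const (normal_mx (@lconst F) (lvar F ^+ a) w N).
    rewrite (map_normal_mx x_laurent) (map_normal_mx x_const) x_laurent_var.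
    congr (normal_mx _ _ w N).
    by apply: funext => c; apply: x_laurent_const.
  rewrite -(map_mxZ x_const) /chain_factor normal_mx_ramify ?lvar_neq0 //.
  by apply/matrixP => i j; rewrite mxE [RHS]mxE [in RHS]mxE.
have {}dT := etrans dT (congr2 (fun X Y => X *m _ - _ *m Y) eM eD).
have [m [V eV]] := laurent_mx_pole (map_mx x_laurent T).
have t0 : (lvar L ^+ m)^-1 != 0 by rewrite invr_eq0 expf_neq0 ?lvar_neq0.
exists V.
  apply: contraTneq uT' => V0.
  by rewrite unitmxE unitfE eV detZ det_map_mx V0 rmorph0 mulr0 eqxx.
rewrite eV in dT.
apply: (@clear_denominator _ _ (@FracField.tofrac {fps L}) _ _ _ _ _ _ _ _ t0 _ dT).
  by move=> x y /eqP; rewrite tofrac_eq => /eqP.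
exact: x_laurent_deriv_pole.
Qed.

End SecondVariable.

(** * Comparison of exponential parts *)

(** The bivariate system comes with the ramification b and the ordinary one with a.
    Both are ramified to a b, where [laurent_intertwiner] applies. *)
Lemma compare_exp_parts (F : fieldType) n (a b q : nat)
    (C : 'M[{fps {fps F}}]_n) (C0 : 'M[{fps F}]_n)
    (w w' : 'I_n -> {poly F}) (N N' : 'M[F]_n)
    (T : 'M[laurent2 F]_n) (T' : 'M[laurent F]_n) :
    (0 < a)%N -> (0 < b)%N -> a%:R != 0 :> F -> b%:R != 0 :> F ->
    compatible w N -> compatible w' N' ->
    (forall i, polar_part (w i)) -> (forall i, polar_part (w' i)) ->
    map_mx (@at_x0 F) C = map_mx (@fps_ramify F b) C0 ->
    T \in unitmx -> T' \in unitmx ->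
    map_mx (@deriv_y F) T =
      ((b%:R / var_y F) *: ((var_y F ^+ (b * q))^-1 *: map_mx (@FracField.tofrac _) C)) *m T
        - T *m normal_mx (@const2 F) (var_y F) w N ->
    map_mx (@lderiv F) T' =
      ode_ramified a ((lvar F ^+ q)^-1 *: map_mx (@FracField.tofrac _) C0) *m T'
        - T' *m normal_mx (@lconst F) (lvar F) w' N' ->
  exists s : 'S_n, forall i, puiseux_form a (w' i) = puiseux_form b (w (s i)).
Proof.
move=> a0 b0 aF bF cN cN' w0 w'0 eC uT uT' dT dT'.
have [V V0 dV] := expand_system a0 uT w0 dT.
have dP := transport (lderiv_lramify b0) dT'.
have eD : (b%:R * lvar F ^+ b.-1) *: map_mx (lramify_morph F b0)
    (normal_mx (@lconst F) (lvar F) w' N') =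
    normal_mx (@lconst F) (lvar F) (fun i => polar_ramify b (w' i)) (b%:R *: N').
  rewrite -normal_mx_ramify ?lvar_neq0 // (map_normal_mx (lramify_morph F b0)) lramify_lvar.
  suff -> : lramify_morph F b0 \o @lconst F = @lconst F by [].
  by apply: funext => c; apply: lramify_lconst.
have eL : map_mx (lramify_morph F b0)
    (map_mx (lramify_morph F a0) (map_mx (@FracField.tofrac _) C0)) =
    map_mx (y_subst F a0) (map_mx (@at_x0 F) C).
  rewrite eC; apply/matrixP => i j; rewrite mxE mxE mxE [RHS]mxE [in RHS]mxE.
  by rewrite (lramify_tofrac a0) (lramify_tofrac b0) y_substE fps_ramify_comm.
have eM := scale_map_ode (b%:R * lvar F ^+ b.-1) q
  (map_mx (@FracField.tofrac _) C0) (lramify_lvar F a0) (lramify_lvar F b0).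
rewrite eL (ramified_scalar q a0 b0 (lvar_neq0 F)) in eM.
have eM' := etrans eM (esym (mx_coef0_scale_map (y_subst F a0) _ C)).
have [s sE] := laurent_intertwiner (compatible_ramify b0 cN') (compatible_ramify a0 cN)
  (etrans (map_unitmx (lramify_morph F b0) T') uT')
  (etrans dP (congr2 (fun X Y => X *m _ - _ *m Y) eM' eD)) dV V0.
exists s => i; rewrite -(puiseux_ramify (w' i) a0 b0 bF) -(puiseux_ramify (w (s i)) b0 a0 aF).
by rewrite mulnC; apply: eq_puiseux; apply: sE.
Qed.

Section Bivariate.
Variable F : fieldType.

Section Ramify2.
Variables (a b : nat) (a0 : (0 < a)%N) (b0 : (0 < b)%N).

(** f(x, y) |-> f(x^a, y^b) *)
Definition fps_ramify2 : {rmorphism {fps {fps F}} -> {fps {fps F}}} :=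
  ramify_fps (R := {fps F}) a0 \o fps_map (ramify_fps (R := F) b0).

Lemma fps_ramify2_inj : injective fps_ramify2.
Proof.
move=> f g /(@fps_ramify_inj {fps F} a a0).
exact: (@fps_map_inj _ _ (ramify_fps (R := F) b0) (@fps_ramify_inj F b b0)).
Qed.

Definition ramify2_morph : {rmorphism laurent2 F -> laurent2 F} := frac_mapm fps_ramify2_inj.

Lemma ramify2_tofrac f : ramify2_morph f%:F = (fps_ramify2 f)%:F.
Proof. exact: (@frac_map_tofrac _ _ fps_ramify2 fps_ramify2_inj). Qed.

Lemma ramify2_x : ramify2_morph (var_x F) = var_x F ^+ a.
Proof.
have e : fps_ramify2 fpsX = fpsX ^+ a.
  by rewrite [LHS](congr1 (fps_ramify a) (fps_mapX _)) fps_ramifyX.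
by rewrite ramify2_tofrac e tofracXn.
Qed.

Lemma ramify2_y : ramify2_morph (var_y F) = var_y F ^+ b.
Proof.
have e : fps_ramify2 (fpsC fpsX) = fpsC fpsX ^+ b.
  rewrite [LHS](congr1 (fps_ramify a) (fps_mapC (ramify_fps (R := F) b0) _)).
  by rewrite fps_ramifyC //= /ramify_fps fps_ramifyX // rmorphXn.
by rewrite ramify2_tofrac e tofracXn.
Qed.

Lemma at_x0_ramify2 f : at_x0 (fps_ramify2 f) = fps_ramify b (at_x0 f).
Proof. by rewrite /at_x0 /= dvdn0 div0n. Qed.

Lemma at_y0_ramify2 f : at_y0 (fps_ramify2 f) = fps_ramify a (at_y0 f).
Proof.
apply: fpsP => k /=; case: ifP => // _; rewrite /= dvdn0 div0n //.
Qed.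
End Ramify2.

Let swap : {rmorphism {fps {fps F}} -> {fps {fps F}}} := @fps_swap F.

Lemma swap_inj : injective swap.
Proof. exact: can_inj (@fps_swapK F). Qed.

Definition swap_xy : {rmorphism laurent2 F -> laurent2 F} := frac_mapm swap_inj.

Lemma swap_xy_tofrac f : swap_xy f%:F = (fps_swap f)%:F.
Proof. exact: (@frac_map_tofrac _ _ swap swap_inj). Qed.

Lemma swap_xy_x : swap_xy (var_x F) = var_y F.
Proof. by rewrite swap_xy_tofrac fps_swapX. Qed.

Lemma swap_xy_const c : swap_xy (const2 c) = const2 c.
Proof. by rewrite swap_xy_tofrac fps_swapCC. Qed.

Lemma deriv_swap_xy z : deriv_y (swap_xy z) = 1 * swap_xy (deriv_x z).
Proof.
rewrite -tofrac1.
apply: (@frac_deriv_map _ _ _ _ swap 1 z (@fps_deriv_leibniz _)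
  (fps_map_leibniz (@fps_deriv_leibniz F)) swap_inj).
by move=> f; rewrite mul1r [RHS]fps_swap_deriv.
Qed.

Lemma at_x0_swap (f : {fps {fps F}}) : at_x0 (fps_swap f) = at_y0 f.
Proof. exact: fpsP. Qed.

End Bivariate.

Lemma scale_map_ramified (K : fieldType) (u : {rmorphism K -> K}) (c t : K) a p n
    (X : 'M[K]_n) : u t = t ^+ a ->
  c *: map_mx u ((t ^+ p)^-1 *: X) = c *: ((t ^+ (a * p))^-1 *: map_mx u X).
Proof. by move=> ut; rewrite map_mxZ fmorphV rmorphXn ut exprM. Qed.

(** A matching of the positions is an equality of the lists up to order. *)
Lemma perm_eq_reindex (T : eqType) n (f g : 'I_n -> T) (s : 'S_n) :
  (forall i, f i = g (s i)) ->
  perm_eq [seq g i | i <- enum 'I_n] [seq f i | i <- enum 'I_n].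
Proof.
move=> fg; rewrite (eq_map fg) (map_comp g s); apply: perm_map.
apply: uniq_perm; rewrite ?(map_inj_uniq (@perm_inj _ s)) ?enum_uniq // => i.
transitivity true; first by rewrite mem_enum.
by apply/esym/mapP; exists (s^-1%g i); rewrite ?mem_enum ?permKV.
Qed.

Section Comparison.
Variables (F : fieldType) (n p q : nat) (S : pfaffian_system F n p q).
Hypothesis char0 : forall m, (0 < m)%N -> m%:R != 0 :> F.

(* The data behind the exponential parts of an ordinary system, flattened. *)
Let normalize_ode (M : 'M[laurent F]_n) (E : seq (rat -> F)) :
  ode_exp_parts M E -> exists a (w : 'I_n -> {poly F}) (N : 'M[F]_n) (T : 'M[laurent F]_n),
    [/\ (0 < a)%N, compatible w N /\ (forall i, polar_part (w i)), T \in unitmx,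
      map_mx (@lderiv F) T = ode_ramified a M *m T - T *m normal_mx (@lconst F) (lvar F) w N
    & perm_eq E [seq puiseux_form a (w i) | i <- enum 'I_n] ].
Proof.
move=> [a [s [w [N [T [a0 w0 uT G pE]]]]]].
have w0' k : polar_part (w k) by have [] := w0 k.
have [wf [Nf [cN wf0 eN pw]]] := block_diag_normal N w0'.
exists a, wf, Nf, T; split=> //; last exact: perm_trans pE (pw a).
by apply: gauge_eq => //; rewrite G (eN _ (@lconst F)).
Qed.

Lemma y_exp_parts_ode E E' :
  y_exp_parts S E -> ode_exp_parts (matB_x0 S) E' -> perm_eq E E'.
Proof.
move=> [b [a1 [s [w1 [w [N1 [N [T [[[b0 a0] _ w0 uT [_ G]] pE]]]]]]]]].
have w0' k : polar_part (w k) by have [] := w0 k.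
have [wf [Nf [cN wf0 eN pw]]] := block_diag_normal N w0'.
move=> /normalize_ode[a [w' [N' [T' [a'0 [cN' w'0] uT' dT' pE']]]]].
have dT : map_mx (@deriv_y F) T =
    ((a1%:R / var_y F) *: ((var_y F ^+ (a1 * q))^-1 *:
       map_mx (@FracField.tofrac _) (map_mx (fps_ramify2 F b0 a0) (numB S)))) *m T
      - T *m normal_mx (@const2 F) (var_y F) wf Nf.
  have eM := scale_map_ramified (a1%:R / var_y F) q
    (map_mx (@FracField.tofrac _) (numB S)) (ramify2_y F b0 a0).
  have eX : map_mx (ramify2_morph F b0 a0) (map_mx (@FracField.tofrac _) (numB S)) =
      map_mx (@FracField.tofrac _) (map_mx (fps_ramify2 F b0 a0) (numB S)).
    by apply/matrixP => i j; rewrite mxE mxE ramify2_tofrac [RHS]mxE [in RHS]mxE.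
  rewrite eX in eM; exact: (etrans (gauge_eq uT G)
    (congr2 (fun X Y => X *m T - T *m Y) eM (eN _ (@const2 F) (var_y F)))).
have eC : map_mx (@at_x0 F) (map_mx (fps_ramify2 F b0 a0) (numB S)) =
    map_mx (@fps_ramify F a1) (map_mx (@at_x0 F) (numB S)).
  by apply/matrixP => i j; rewrite !mxE at_x0_ramify2.
have dT'' : map_mx (@lderiv F) T' =
    ode_ramified a ((lvar F ^+ q)^-1 *: map_mx (@FracField.tofrac _)
      (map_mx (@at_x0 F) (numB S))) *m T' - T' *m normal_mx (@lconst F) (lvar F) w' N'.
  by rewrite -map_mx_comp.
have [z zE] := compare_exp_parts a'0 a0 (char0 a'0) (char0 a0) cN cN' wf0 w'0 eC uT uT' dT dT''.
apply: perm_trans pE _; apply: perm_trans (pw _) _.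
by rewrite perm_sym; apply: perm_trans pE' _; rewrite perm_sym; apply: perm_eq_reindex zE.
Qed.

(** The exchange of the variables turns the system in x into a system in y with
    numerator [C], to which [compare_exp_parts] applies. *)
Lemma x_exp_parts_ode E E' :
  x_exp_parts S E -> ode_exp_parts (matA_y0 S) E' -> perm_eq E E'.
Proof.
move=> [b [a1 [s [w [w1 [N [N1 [T [[[b0 a0] w0 _ uT [G _]] pE]]]]]]]]].
have w0' k : polar_part (w k) by have [] := w0 k.
have [wf [Nf [cN wf0 eN pw]]] := block_diag_normal N w0'.
move=> /normalize_ode[a [w' [N' [T' [a'0 [cN' w'0] uT' dT' pE']]]]].
have dT : map_mx (@deriv_x F) T =
    ((b%:R / var_x F) *: ((var_x F ^+ (b * p))^-1 *:
       map_mx (@FracField.tofrac _) (map_mx (fps_ramify2 F b0 a0) (numA S)))) *m T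
      - T *m normal_mx (@const2 F) (var_x F) wf Nf.
  have eM := scale_map_ramified (b%:R / var_x F) p
    (map_mx (@FracField.tofrac _) (numA S)) (ramify2_x F b0 a0).
  have eX : map_mx (ramify2_morph F b0 a0) (map_mx (@FracField.tofrac _) (numA S)) =
      map_mx (@FracField.tofrac _) (map_mx (fps_ramify2 F b0 a0) (numA S)).
    by apply/matrixP => i j; rewrite mxE mxE ramify2_tofrac [RHS]mxE [in RHS]mxE.
  rewrite eX in eM; exact: (etrans (gauge_eq uT G)
    (congr2 (fun X Y => X *m T - T *m Y) eM (eN _ (@const2 F) (var_x F)))).
pose C := map_mx (@fps_swap F) (map_mx (fps_ramify2 F b0 a0) (numA S)).
have dTy := transport (@deriv_swap_xy F) dT.
have eM : 1 *: map_mx (swap_xy F) ((b%:R / var_x F) *: ((var_x F ^+ (b * p))^-1 *: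
       map_mx (@FracField.tofrac _) (map_mx (fps_ramify2 F b0 a0) (numA S)))) =
    (b%:R / var_y F) *: ((var_y F ^+ (b * p))^-1 *: map_mx (@FracField.tofrac _) C).
  rewrite scale1r !map_mxZ (fmorphV (swap_xy F)) (rmorphXn (swap_xy F)) (fmorph_div (swap_xy F)).
  rewrite (rmorph_nat (swap_xy F)) swap_xy_x; congr (_ *: (_ *: _)).
  by apply/matrixP => i j; rewrite mxE mxE swap_xy_tofrac [RHS]mxE [in RHS]mxE.
have eD : 1 *: map_mx (swap_xy F) (normal_mx (@const2 F) (var_x F) wf Nf) =
    normal_mx (@const2 F) (var_y F) wf Nf.
  rewrite scale1r (map_normal_mx (swap_xy F)) swap_xy_x.
  suff -> : swap_xy F \o @const2 F = @const2 F by [].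
  by apply: funext => c; apply: swap_xy_const.
have eC : map_mx (@at_x0 F) C = map_mx (@fps_ramify F b) (map_mx (@at_y0 F) (numA S)).
  by apply/matrixP => i j; rewrite !mxE at_x0_swap at_y0_ramify2.
have dT'' : map_mx (@lderiv F) T' =
    ode_ramified a ((lvar F ^+ p)^-1 *: map_mx (@FracField.tofrac _)
      (map_mx (@at_y0 F) (numA S))) *m T' - T' *m normal_mx (@lconst F) (lvar F) w' N'.
  by rewrite -map_mx_comp.
have uTs : map_mx (swap_xy F) T \in unitmx by rewrite map_unitmx.
have {}dTy := etrans dTy (congr2 (fun X Y => X *m _ - _ *m Y) eM eD).
have [z zE] := compare_exp_parts a'0 b0 (char0 a'0) (char0 b0) cN cN' wf0 w'0 eC uTs uT' dTy dT''.
apply: perm_trans pE _; apply: perm_trans (pw _) _.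
by rewrite perm_sym; apply: perm_trans pE' _; rewrite perm_sym; apply: perm_eq_reindex zE.
Qed.
End Comparison.

Theorem theorem3 (R : realType) (n p q : nat) (S : pfaffian_system R[i] n p q) :
  (forall E E' : seq (rat -> R[i]),
     x_exp_parts S E -> ode_exp_parts (matA_y0 S) E' -> perm_eq E E') /\
  (forall E E' : seq (rat -> R[i]),
     y_exp_parts S E -> ode_exp_parts (matB_x0 S) E' -> perm_eq E E').
Proof.
have char0 m : (0 < m)%N -> m%:R != 0 :> R[i].
  by move=> m0; rewrite Num.Theory.pnatr_eq0 -lt0n.
by split=> E E'; [apply: x_exp_parts_ode | apply: y_exp_parts_ode].
Qed.
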